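(* Let $q$ be a fixed prime power, $p=\mathrm{char}(\mathbf{F}_q)$, and $a=|\mathrm{Aut}(\mathbf{F}_q)|=\log_p(q)$. Let $N_{n,q}^{\mathfrak{S}}$, $N_{n,q}^{\mathfrak{M}}$, $N_{n,q}^{\Gamma}$ be the numbers of linear $q$-ary codes of length $n$ up to permutation equivalence, monomial equivalence and semi-linear monomial equivalence, respectively. Then, as $n\to\infty$, $$N_{n,q}^{\mathfrak{S}}\sim\frac{1}{n!}\sum_{\substack{\pi\in\mathfrak{S}_n\\ \operatorname{des}(\pi)\leq 1}}\binom{n+1-\operatorname{des}(\pi)}{n}q^{\operatorname{inv}(\pi)},$$ $$N_{n,q}^{\mathfrak{M}}\sim\frac{1}{n!(q-1)^{n-1}}\sum_{\substack{\pi\in\mathfrak{S}_n\\ \operatorname{des}(\pi)\leq 1}}\binom{n+1-\operatorname{des}(\pi)}{n}q^{\operatorname{inv}(\pi)},$$ $$N_{n,q}^{\Gamma}\sim\frac{1}{n!(q-1)^{n-1}a}\sum_{\substack{\pi\in\mathfrak{S}_n\\ \operatorname{des}(\pi)\leq 1}}\binom{n+1-\operatorname{des}(\pi)}{n}q^{\operatorname{inv}(\pi)}.$$ In particular, the numerator of each of these asymptotic numbers is the (weighted) inversion statistic on the permutations having at most $1$ descent.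
   Context: A linear $q$-ary code of length $n$ is a linear subspace of $\mathbf{F}_q^n$ (of any dimension). Two codes are permutation equivalent ($\mathfrak{S}$) if one is mapped to the other by a permutation of coordinates; monomially equivalent ($\mathfrak{M}$) if one is mapped to the other by an invertible monomial matrix (a permutation of coordinates combined with multiplication of each coordinate by a nonzero scalar); semi-linearly monomially equivalent ($\Gamma$) if one is mapped to the other by a monomial transformation composed with a field automorphism of $\mathbf{F}_q$ applied to all coordinates. $f(n)\sim g(n)$ means $\lim_{n\to\infty}f(n)/g(n)=1$. $\mathfrak{S}_n$ is the symmetric group on $n$ elements; for $\pi\in\mathfrak{S}_n$, $\operatorname{des}(\pi)=|\{i:\pi(i)>\pi(i+1)\}|$ and $\operatorname{inv}(\pi)=|\{(i,j): i<j,\ \pi(i)>\pi(j)\}|$. *)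

(* Defs.v *)
From HB Require Import structures.
From mathcomp Require Import all_boot all_order all_fingroup all_algebra.
From mathcomp Require Import all_classical all_reals all_analysis.

Set Implicit Arguments.
Unset Strict Implicit.
Unset Printing Implicit Defensive.

Import Order.TTheory GRing.Theory Num.Theory.
Import numFieldNormedType.Exports.

Local Open Scope ring_scope.

Section Codes.
Variables (F : finFieldType) (n : nat).

(* A code is represented by its set of codewords rather than as a             *)
(* {vspace 'rV[F]_n}, because {vspace _} has no finType structure.            *)
Definition linear_codes : {set {set 'rV[F]_n}} :=
  [set C : {set 'rV[F]_n} | `[< GRing.submod_closed C >]].

Definition monomial_mx (M : 'M[F]_n) : bool :=
  [exists s : 'S_n, exists d : 'rV[F]_n,
     [forall i, d ord0 i != 0] && (M == diag_mx d *m perm_mx s)].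

Definition field_auts : {set {perm F}} :=
  [set s : {perm F} | `[< nmod_morphism s /\ monoid_morphism s >]].

Definition perm_equiv (C D : {set 'rV[F]_n}) : bool :=
  [exists s : 'S_n, D == [set col_perm s u | u in C]].

Definition monomial_equiv (C D : {set 'rV[F]_n}) : bool :=
  [exists M : 'M[F]_n, monomial_mx M && (D == [set u *m M | u in C])].

Definition semilinear_equiv (C D : {set 'rV[F]_n}) : bool :=
  [exists s in field_auts, exists M : 'M[F]_n,
     monomial_mx M && (D == [set map_mx s u *m M | u in C])].

Definition num_classes (e : rel {set 'rV[F]_n}) : nat :=
  #|equivalence_partition e linear_codes|.

End Codes.

Definition num_codes_perm (F : finFieldType) (n : nat) : nat :=
  num_classes (@perm_equiv F n).
Definition num_codes_monomial (F : finFieldType) (n : nat) : nat :=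
  num_classes (@monomial_equiv F n).
Definition num_codes_semilinear (F : finFieldType) (n : nat) : nat :=
  num_classes (@semilinear_equiv F n).

Definition des (n : nat) (s : 'S_n) : nat :=
  #|[set ij : 'I_n * 'I_n | (ij.2 == ij.1.+1 :> nat) && (s ij.2 < s ij.1)%N]|.

Definition inv (n : nat) (s : 'S_n) : nat :=
  #|[set ij : 'I_n * 'I_n | (ij.1 < ij.2)%N && (s ij.2 < s ij.1)%N]|.

Definition des_inv_sum (q n : nat) : nat :=
  (\sum_(s : 'S_n | des s <= 1) 'C(n.+1 - des s, n) * q ^ inv s)%N.

(* The library's [~_] relation of landau.v is stated with little-o; this is   *)
(* the definition by the limit of the quotient.                               *)
Definition asymp_equiv (R : realType) (f g : nat -> R) : Prop :=
  ((fun n => f n / g n) @ \oo --> (1 : R))%classic.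

(* Main.v *)
From HB Require Import structures.
From mathcomp Require Import all_classical all_reals all_analysis.
From mathcomp Require Import all_boot all_order all_fingroup all_algebra all_field.
From mathcomp Require Import zify ring.
Require Import Defs.

Set Implicit Arguments.
Unset Strict Implicit.
Unset Printing Implicit Defensive.

Import Order.TTheory GRing.Theory Num.Theory.
Import numFieldNormedType.Exports.

Local Open Scope ring_scope.

(** Each of the three equivalences is the orbit relation, on codes, of a group
    of maps g = (sigma, d, s): apply the field automorphism sigma to every
    coordinate, multiply coordinate i by d_i, permute the coordinates by s.
    Here sigma ranges over a group A of automorphisms and the d_i over a set S
    of nonzero scalars, with (A, S) = (1, {1}), (1, F\0) or (Aut F, F\0).  By
    the Cauchy-Frobenius formula the number of classes times |A| |S|^n n! is
    the sum over all g of the number of g-invariant subspaces of F^n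
    ([num_classes_monomial]).  The |S| scalar maps fix all subspaces.  So with
    G_n the number of subspaces of F^n, the theorem reduces to two facts: the
    numerator is G_n, and the nonscalar g contribute o(G_n).

    The numerator is G_n.  The coefficient 'C(n + 1 - des s, n) counts the
    cut points k such that s increases on [0, k) and on [k, n)
    ([card_grassmannian]).  Such an s amounts to the k-subset s([0, k)), and its
    inversions are the pairs x in the subset, y < x outside of it.  Counting
    k-subsets with this weight obeys the q-Pascal rule, so it gives the Gaussian
    binomial coefficient, which counts the subspaces of dimension k
    ([des_inv_sum_qbinom], [card_subspaces]).

    The nonscalar maps are negligible.  As G_n >= q^floor(n^2/4), it is a matter
    of exponents.  For a scalar lam let t(lam) be the number of coordinates i for
    which s i = i and d_i = lam does not hold.  At most (q n^2)^t pairs (d, s)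
    have t(lam) = t for a given lam.  On the other hand [card_invariant_le]
    provides a lam with t(lam) > 0 for which g has at most
    poly(n) q^(n^2/4 - c n t(lam)) invariant subspaces.  Hence the nonscalar
    maps contribute at most G_n poly(n) q n^2 q^(-cn) ([sum_nonscalar_le]).

    The bound on invariant subspaces U is proved for each dimension k.  If k is
    not close to n/2, there are few subspaces of dimension k at all.  Otherwise
    k(n-k) is about n^2/4, and invariance must cost a factor.

    - If g is linear and close to a scalar lam, put h = g - lam, of rank r with
      r <= t(lam) <= 3r.  An invariant U contains the subspace of ker h cut out
      by it, of dimension k - b, and the subspace h(U) of im h, of dimension b.
      Choosing first that subspace inside the fixed space ker h (or im h) and
      then U above it lowers the exponent k(n-k) by (k-b)(r-b), respectively
      b(n-k-r+b).  The former is large if b <= r/2, the latter if b >= r/2.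

    - If not, pick m proportional to n.  Either U contains m vectors that
      together with their images are independent; then U is generated under g
      by a subspace of dimension k - m, and there are few of those.  Or g acts
      on U as a scalar modulo a space of dimension less than 2m
      ([invariant_generated_or_scalar]); then g is linear, and the first
      estimate above, with b < 2m and r at least of order n, saves a multiple
      of n^2 in the exponent. *)

(** * Counting subspaces of a finite vector space *)

Section FiniteVspace.
Variables (F : finFieldType) (vT : vectType F).
Let vs2mxK : cancel (@VectorInternalTheory.vs2mx F vT) VectorInternalTheory.mx2vs
  := @VectorInternalTheory.vs2mxK F vT.
HB.instance Definition _ := Countable.copy {vspace vT} (can_type vs2mxK).
HB.instance Definition _ : isFinite {vspace vT} := CanIsFinite vs2mxK.
End FiniteVspace.

Lemma dimv_add_line (F : fieldType) (vT : vectType F) (B : {vspace vT}) v :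
  v \notin B -> \dim (B + <[v]>) = (\dim B).+1.
Proof.
move=> vB; rewrite dimv_disjoint_sum; last first.
  apply/eqP; rewrite -subv0; apply/subvP=> w.
  rewrite memv_cap => /andP[wB /vlineP[c def_w]]; rewrite memv0.
  move: wB; rewrite def_w rpredZeq (negbTE vB) orbF => /eqP->.
  by rewrite scale0r.
rewrite dim_vline -addn1; congr (_ + _)%N.
by case: eqP vB => // ->; rewrite mem0v.
Qed.

Section SubspaceCount.
Variables (F : finFieldType) (n : nat).
Local Notation V := 'rV[F]_n.
Local Notation q := #|F|.
Implicit Types (B E U : {vspace V}) (k : nat).

Lemma card_vspaceD B E : (B <= E)%VS ->
  #|[predD E & B]| = (q ^ \dim E - q ^ \dim B)%N.
Proof.
move=> sBE; rewrite -!card_vspace -[#|E|](cardID (mem B) (mem E)).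
have -> : #|[predI mem E & mem B]| = #|B|.
  apply: eq_card => v; rewrite !inE andbC.
  by case vB: (v \in B); rewrite //= (subvP sBE).
by rewrite addKn; apply: eq_card => v; rewrite !inE.
Qed.

Definition subspaces_between B E k :=
  [set U | [&& (B <= U)%VS, (U <= E)%VS & \dim U == k]].

(** Double counting of the pairs (U, v) with v in U but not in B.  Iterated, it
    reduces counts of subspaces above B to counts above larger subspaces, so
    that no quotient space is needed. *)
Lemma card_subspaces_between_extend B E k : (B <= E)%VS ->
  (#|subspaces_between B E k| * (q ^ k - q ^ \dim B) =
    \sum_(v in E | v \notin B) #|subspaces_between (B + <[v]>) E k|)%N.
Proof.
move=> sBE; under eq_bigr do rewrite -sum1_card.
rewrite (exchange_big_dep (mem (subspaces_between B E k))) /=; last first.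
  move=> v U _; rewrite !inE => /and3P[+ -> ->].
  by rewrite subv_add => /andP[->].
rewrite -sum_nat_const; apply: eq_bigr => U; rewrite inE => /and3P[sBU sUE /eqP dU].
rewrite sum1_card -dU -card_vspaceD //.
apply: eq_card => v; rewrite [RHS]unfold_in !inE eqxx sUE subv_add sBU /=.
rewrite -memvE; case vU: (v \in U); rewrite ?andbF //= !andbT.
by rewrite (subvP sUE) ?andTb.
Qed.

Lemma subspaces_between_small B E k :
  (\dim E < k)%N -> subspaces_between B E k = set0.
Proof.
move=> ltEk; apply/setP=> U; rewrite !inE; apply/negP=> /and3P[_ /dimvS + /eqP dU].
by rewrite dU leqNgt ltEk.
Qed.

(** With c = k - dim B, each extension step costs a factor
    q^(dim E) / (q^k - q^(dim B)), which is q^(dim E - k) / (1 - q^(-c)) and so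
    at most q^(dim E - k) (c + 1) / c.  These factors (c + 1) / c telescope to
    the polynomial k - dim B + 1. *)
Lemma card_subspaces_between_le B E k : (\dim B <= k)%N ->
  (#|subspaces_between B E k|
     <= (k - \dim B).+1 * q ^ ((\dim E - k) * (k - \dim B)))%N.
Proof.
have q_gt1 : (1 < q)%N by exact: finNzRing_gt1.
have [ltEk _|leEk] := ltnP (\dim E) k.
  by rewrite subspaces_between_small ?cards0.
have [d def_d] := ubnP (k - \dim B); elim: d => // d IHd in B def_d *.
rewrite leq_eqVlt => /orP[/eqP dB|ltBk].
  rewrite dB subnn muln0 expn0 muln1.
  suff /subset_leq_card : subspaces_between B E k \subset [set B] by rewrite cards1.
  apply/subsetP=> U; rewrite !inE => /and3P[sBU _ /eqP dU].
  by rewrite eq_sym eqEdim sBU dU dB leqnn.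
have [/negbTE nsBE|sBE] := boolP (~~ (B <= E)%VS).
  rewrite (_ : subspaces_between B E k = set0) ?cards0 //.
  apply/setP=> U; rewrite !inE; apply/negP=> /and3P[sBU sUE _].
  by rewrite (subv_trans sBU) in nsBE.
have {}sBE := negbNE sBE.
have := card_subspaces_between_extend k sBE.
set N := #|_|; set c := (k - \dim B)%N; set D := \dim E => eqN.
have leN : (N * (q ^ k - q ^ \dim B) <= q ^ D * (c * q ^ ((D - k) * c.-1)))%N.
  rewrite eqN -card_vspace -sum_nat_const big_mkcondr /=.
  apply: leq_sum => v vE; case: ifP => // vB.
  have dBv : \dim (B + <[v]>) = (\dim B).+1 by rewrite dimv_add_line ?vB.
  apply: leq_trans (IHd _ _ _) _; rewrite ?dBv //; first by lia.
  by rewrite subnS -/c prednK // /c; lia.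
have c_gt0 : (0 < c)%N by rewrite subn_gt0.
have def_k : (k = c + \dim B)%N by rewrite subnK // ltnW.
have cq : (c * q ^ k <= c.+1 * (q ^ k - q ^ \dim B))%N.
  rewrite def_k expnD -[X in (_ - X)%N]mul1n -mulnBl !mulnA leq_mul2r.
  by have := ltn_expl c q_gt1; nia.
rewrite -(@leq_pmul2l (c * q ^ k)) ?muln_gt0 ?c_gt0 ?expn_gt0 ?(ltnW q_gt1) //.
apply: (@leq_trans (N * (c.+1 * (q ^ k - q ^ \dim B)))).
  by rewrite mulnC leq_mul2l cq orbT.
rewrite mulnCA; apply: leq_trans (leq_mul (leqnn _) leN) _.
have -> : (q ^ D = q ^ (D - k) * q ^ k)%N by rewrite -expnD subnK.
have -> : (q ^ ((D - k) * c) = q ^ (D - k) * q ^ ((D - k) * c.-1))%N.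
  by rewrite -expnD -mulnS prednK.
by apply/eq_leq; ring.
Qed.

Lemma card_subspaces_between B E k : (B <= E)%VS -> (\dim B <= k)%N ->
  (#|subspaces_between B E k| * \prod_(\dim B <= i < k) (q ^ k - q ^ i) =
     \prod_(\dim B <= i < k) (q ^ \dim E - q ^ i))%N.
Proof.
have [d def_d] := ubnP (k - \dim B); elim: d => // d IHd in B def_d *.
move=> sBE; rewrite leq_eqVlt => /orP[/eqP dB|ltBk].
  rewrite dB !big_geq // muln1; suff -> : subspaces_between B E k = [set B].
    by rewrite cards1.
  apply/setP=> U; rewrite !inE; apply/and3P/eqP=> [[sBU _ /eqP dU]|->].
    by apply/eqP; rewrite eq_sym eqEdim sBU dU dB leqnn.
  by rewrite subvv sBE dB.
rewrite big_ltn // [RHS]big_ltn // mulnA card_subspaces_between_extend // big_distrl /=.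
rewrite -card_vspaceD //.
rewrite -sum_nat_const; apply: eq_big => [v|v /andP[vE vB]].
  by rewrite !inE andbC.
have dBv : \dim (B + <[v]>) = (\dim B).+1 by rewrite dimv_add_line ?vB.
rewrite -dBv IHd ?dBv //; first by lia.
by rewrite subv_add sBE -memvE.
Qed.

End SubspaceCount.

(** * Inversions of permutations with at most one descent *)

Section GaussianBinomial.

(** The Gaussian binomial coefficient evaluated at q.  This form of the q-Pascal
    rule is the one obtained by deleting the greatest element of a set.  For
    n' < k' the truncated exponent is harmless, the second factor being 0. *)
Fixpoint qbinom (q n k : nat) : nat :=
  match n, k with
  | _, 0 => 1
  | 0, _.+1 => 0
  | n'.+1, k'.+1 => qbinom q n' k + q ^ (n' - k') * qbinom q n' k'
  end.

Lemma qbinom_small q n k : (n < k)%N -> qbinom q n k = 0%N.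
Proof.
elim: n k => [|n IHn] [|k] //= lt_nk; rewrite !IHn ?muln0 //; exact: ltnW.
Qed.

Lemma qbinom_prod q n k : (0 < q)%N ->
  (qbinom q n k * \prod_(i < k) (q ^ k - q ^ i) = \prod_(i < k) (q ^ n - q ^ i))%N.
Proof.
move=> q_gt0.
have step m j : (\prod_(i < j.+1) (q ^ m.+1 - q ^ i) =
    (q ^ m.+1 - 1) * q ^ j * \prod_(i < j) (q ^ m - q ^ i))%N.
  rewrite big_ord_recl expn0 -mulnA; congr (_ * _)%N.
  rewrite -[in X in (X * _)%N](card_ord j) -prod_nat_const -big_split /=.
  by apply: eq_bigr => i _; rewrite mulnBr -!expnS.
elim: n k => [|n IHn] [|k]; rewrite ?big_ord0 //=.
  by rewrite mul0n big_ord_recl subnn mul0n.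
have [lt_nk|le_kn] := ltnP n k.
  rewrite !qbinom_small ?leqW // muln0 mul0n step.
  by rewrite (bigD1 (Ordinal lt_nk)) //= subnn mul0n muln0.
rewrite mulnDl IHn big_ord_recr /= !step -IHn.
set P := (\prod_(i < k) _)%N; set H := qbinom q n k.
rewrite -{1}(subnKC le_kn) -{3}(subnKC le_kn) (expnS q (k + _)) expnD (expnS q k).
have := expn_gt0 q k; have := expn_gt0 q (n - k); rewrite q_gt0 /=.
set x := (q ^ k)%N; set y := (q ^ (n - k))%N => y_gt0 x_gt0.
rewrite -{2}[x]muln1 -mulnBr.
have -> : (q * (x * y) - 1 = (y - 1) + y * (q * x - 1))%N by nia.
ring.
Qed.

End GaussianBinomial.

Section Grassmannian.
Variable n : nat.
Implicit Types (s : 'S_n) (S : {set 'I_n}) (k : nat).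

(** This is the number of inversions of the permutation that lists S, then its
    complement, both in increasing order. *)
Definition set_inv S : nat :=
  #|[set xy : 'I_n * 'I_n | [&& xy.1 \in S, xy.2 \notin S & (xy.2 < xy.1)%N]]|.

Definition grassmannian k s : bool :=
  [forall i : 'I_n, forall j : 'I_n,
     (i < j)%N && ((j < k)%N || (k <= i)%N) ==> (s i < s j)%N].

Lemma grassmannianP k s :
  reflect (forall i j : 'I_n, (i < j)%N -> (j < k)%N || (k <= i)%N -> (s i < s j)%N)
          (grassmannian k s).
Proof.
apply: (iffP forallP) => [H i j lt_ij Hk|H i].
  by have /forallP/(_ j) := H i; rewrite lt_ij Hk.
by apply/forallP=> j; apply/implyP=> /andP[]; apply: H.
Qed.

(** Monotonicity on both blocks can be checked on consecutive positions: only a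
    descent across the cut k is allowed. *)
Lemma grassmannian_descents k s :
  grassmannian k s = [forall i : 'I_n, forall j : 'I_n,
     (j == i.+1 :> nat) && (s j < s i)%N ==> (j == k :> nat)].
Proof.
apply/grassmannianP/forallP => [H i|H i j].
  apply/forallP=> j; apply/implyP=> /andP[/eqP def_j lt_ji].
  apply/negPn/negP=> ne_jk; have := H i j; rewrite def_j leqnn => /(_ isT).
  by move: lt_ji ne_jk; rewrite def_j; lia.
have {}H (i' j' : 'I_n) : j' = i'.+1 :> nat -> j' != k :> nat -> (s i' < s j')%N.
  move=> def_j ne_jk; have /forallP/(_ j') := H i'; rewrite def_j eqxx -def_j (negbTE ne_jk).
  rewrite implybF -leqNgt leq_eqVlt => /orP[/eqP/val_inj/perm_inj eq_ij|//].
  by move/eqP: def_j; rewrite eq_ij ltn_eqF.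
have [d] := ubnP (j - i); elim: d => // d IHd in j * => def_d lt_ij Hk.
have [eq_ij|ne_ij] := eqVneq (j : nat) i.+1; first by apply: H; lia.
have lt_jn : (j.-1 < n)%N by apply: leq_ltn_trans (leq_pred _) (ltn_ord j).
apply: (@ltn_trans (s (Ordinal lt_jn))); first by apply: IHd => /=; lia.
by apply: H => /=; lia.
Qed.

(** Without descents all n + 1 cut points are good, with one descent the cut has
    to be there, and two descents leave no choice; these are the binomial
    coefficients of the weighted inversion sum. *)
Lemma card_grassmannian s :
  #|[set k : 'I_n.+1 | grassmannian k s]| = ((des s <= 1) * 'C(n.+1 - des s, n))%N.
Proof.
pose D := [set ij : 'I_n * 'I_n | (ij.2 == ij.1.+1 :> nat) && (s ij.2 < s ij.1)%N].
have -> : des s = #|D| by [].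
have gE (k : 'I_n.+1) :
    grassmannian k s = [forall ij in D, ij.2 == k :> nat].
  rewrite grassmannian_descents; apply/forallP/forall_inP => [H [i j]|H i].
    by rewrite inE /=; have /forallP/(_ j)/implyP := H i.
  by apply/forallP=> j; apply/implyP=> Dij; apply: (H (i, j)); rewrite inE.
have [D0|[[i j] Dij]] := set_0Vmem D.
  rewrite D0 cards0 subn0 binSn mul1n -[RHS]card_ord; apply: eq_card => k.
  by rewrite !inE gE; apply/forall_inP=> ij; rewrite D0 inE.
have def_j : j = i.+1 :> nat by move: Dij; rewrite inE => /andP[/eqP].
have D_gt0 : (0 < #|D|)%N by rewrite card_gt0; apply/set0Pn; exists (i, j).
case: leqP => [D_le1|D_gt1].
  have D1 : #|D| = 1%N by apply/eqP; rewrite eqn_leq D_le1.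
  rewrite D1 subn1 binn muln1; move/eqP/cards1P: D1 => [ij0 def_D].
  have {}def_D : D = [set (i, j)].
    by move: Dij; rewrite def_D inE => /eqP->.
  rewrite (_ : [set k | _] = [set widen_ord (leqnSn n) j]) ?cards1 //.
  apply/setP=> k; rewrite !inE gE def_D -val_eqE /= [RHS]eq_sym.
  apply/forall_inP/idP => [/(_ (i, j))|Hk ij]; rewrite inE ?eqxx //; first exact.
  by move/eqP->.
rewrite mul0n; apply/eqP; rewrite cards_eq0; apply/eqP/setP=> k; rewrite !inE gE.
apply/negP=> /forall_inP H.
suff : (#|D| <= 1)%N by rewrite leqNgt D_gt1.
apply/card_le1_eqP=> -[i1 j1] [i2 j2] D1 D2.
have /eqP/= e1 := H _ D1; have /eqP/= e2 := H _ D2.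
move: D1 D2; rewrite !inE /= => /andP[/eqP e3 _] /andP[/eqP e4 _].
by congr (_, _); apply: val_inj => /=; lia.
Qed.

Definition initial_image k s : {set 'I_n} := [set s i | i : 'I_n & (i < k)%N].

Lemma card_initial_image k s : (k <= n)%N -> #|initial_image k s| = k.
Proof.
move=> le_kn; rewrite card_imset; last exact: perm_inj.
rewrite -sum1_card (eq_bigl (fun i : 'I_n => i < k)%N) => [|i]; last by rewrite inE.
by rewrite -(big_ord_widen n (fun=> 1%N)) // sum1_card card_ord.
Qed.

Lemma inv_grassmannian k s :
  grassmannian k s -> inv s = set_inv (initial_image k s).
Proof.
move/grassmannianP=> H; pose f (ij : 'I_n * 'I_n) := (s ij.1, s ij.2).
have f_inj : injective f by move=> [i j] [i' j'] [/perm_inj-> /perm_inj->].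
have mem_im i : (s i \in initial_image k s) = (i < k)%N.
  by rewrite mem_imset ?inE //; apply: perm_inj.
rewrite /inv -(card_imset _ f_inj); apply: eq_card => -[x y].
rewrite !inE /=; apply/imsetP/idP => [[[i j]]|/and3P[]].
  rewrite inE /= => /andP[lt_ij lt_s] [-> ->]; rewrite !mem_im lt_s andbT -leqNgt.
  by have := H i j lt_ij; move: lt_s; case: ltnP; case: ltnP => //=; lia.
rewrite -[x](permKV s) -[y](permKV s) !mem_im => lt_x le_y lt_yx.
exists (s^-1%g x, s^-1%g y); rewrite ?inE //=.
by rewrite lt_yx andbT; lia.
Qed.

Lemma sorted_enum_ord_set S : sorted (fun i j : 'I_n => i < j)%N (enum S).
Proof.
have -> : enum S = [seq x <- enum 'I_n | x \in S] by rewrite enumT.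
rewrite sorted_filter //; first by move=> i j k; apply: ltn_trans.
by have := iota_ltn_sorted 0 n; rewrite -val_enum_ord sorted_map.
Qed.

(** The inverse of s |-> s([0, k)): list the elements of S in increasing order,
    then those of its complement.  That this inverts the map is the uniqueness
    of sorted lists. *)
Lemma exists_grassmannian_perm k : (k <= n)%N ->
  exists f : {set 'I_n} -> 'S_n,
    (forall S, #|S| = k -> grassmannian k (f S) /\ initial_image k (f S) = S) /\
    (forall s, grassmannian k s -> f (initial_image k s) = s).
Proof.
move=> le_kn; pose w S := enum S ++ enum (~: S).
have size_w S : size (w S) = n by rewrite size_cat -!cardE cardsC card_ord.
have uniq_w S : uniq (w S).
  rewrite cat_uniq !enum_uniq andbT; apply/hasPn=> x.
  by rewrite !mem_enum inE.
have w_inj S : injective (fun i : 'I_n => nth i (w S) i).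
  move=> i j; rewrite (set_nth_default i j) ?size_w // => /eqP.
  by rewrite nth_uniq ?size_w // => /eqP/val_inj.
(* All positions are in range, so the default value i of nth is never used. *)
exists (fun S => perm (@w_inj S)); split=> [S cardS|s s_gr].
  have sz : size (enum S) = k by rewrite -cardE.
  have sz' : size (enum (~: S)) = (n - k)%N by rewrite -cardE cardsCs setCK card_ord cardS.
  split.
    apply/grassmannianP=> i j lt_ij Hk; rewrite !permE (set_nth_default i j) ?size_w //.
    have ltn_tr : transitive (fun i j : 'I_n => i < j)%N by move=> x y z; apply: ltn_trans.
    rewrite /w !nth_cat sz; case: (ltnP i k) => Hi; case: (ltnP j k) => Hj; try lia.
      by apply: (sorted_ltn_nth ltn_tr i (sorted_enum_ord_set S)); rewrite ?inE ?sz.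
    apply: (sorted_ltn_nth ltn_tr i (sorted_enum_ord_set (~: S))); rewrite ?inE ?sz'.
    - by have := ltn_ord i; lia.
    - by have := ltn_ord j; lia.
    - by lia.
  apply/eqP; rewrite eqEcard; apply/andP; split.
    apply/subsetP=> _ /imsetP[i Hi ->]; rewrite inE in Hi.
    by rewrite permE /w nth_cat sz Hi -mem_enum mem_nth ?sz.
  by rewrite card_initial_image ?cardS.
set S := initial_image k s.
have mem_S i : (s i \in S) = (i < k)%N.
  by rewrite mem_imset ?inE //; apply: perm_inj.
suff def_w : w S = [seq s i | i <- enum 'I_n].
  apply/permP=> i; rewrite permE def_w (nth_map i) ?size_enum_ord //.
  by rewrite nth_ord_enum.
have ltn_tr : transitive (fun i j : 'I_n => i < j)%N by move=> x y z; apply: ltn_trans.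
have ltn_irr : irreflexive (fun i j : 'I_n => i < j)%N by move=> x; apply: ltnn.
have sorted_ord : sorted (fun i j : 'I_n => i < j)%N (enum 'I_n).
  by have := iota_ltn_sorted 0 n; rewrite -val_enum_ord sorted_map.
have mem_take_ord i : (i \in take k (enum 'I_n)) = (i < k)%N.
  by rewrite in_take ?mem_enum // index_enum_ord.
have mem_drop_ord i : (i \in drop k (enum 'I_n)) = (k <= i)%N.
  have := enum_uniq 'I_n; rewrite -{1}(cat_take_drop k (enum 'I_n)) cat_uniq.
  move=> /and3P[_ /hasPn disj _].
  have : i \in take k (enum 'I_n) ++ drop k (enum 'I_n).
    by rewrite cat_take_drop mem_enum.
  rewrite mem_cat mem_take_ord; case: ltnP => //= lt_ik _.
  by apply/negbTE/negP=> /disj /=; rewrite mem_take_ord lt_ik.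
have map_sorted (P : pred 'I_n) r : {in P &, forall i j : 'I_n, (i < j)%N -> (s i < s j)%N} ->
    all P r -> sorted (fun i j : 'I_n => i < j)%N r ->
    sorted (fun i j : 'I_n => i < j)%N [seq s i | i <- r].
  by rewrite sorted_map => mono; apply: sub_in_sorted.
move/grassmannianP: s_gr => s_gr.
rewrite -(cat_take_drop k (enum 'I_n)) map_cat; congr (_ ++ _).
  apply: (irr_sorted_eq ltn_tr ltn_irr (sorted_enum_ord_set _)) => [|x].
    apply: (map_sorted (fun i => i < k)%N) => [i j Hi Hj lt_ij||].
    - by apply: s_gr => //; rewrite (Hj : (j < k)%N).
    - by apply/allP=> i; rewrite mem_take_ord.
    - exact: take_sorted.
  rewrite mem_enum -[x](permKV s) mem_S mem_map ?mem_take_ord //.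
  exact: perm_inj.
apply: (irr_sorted_eq ltn_tr ltn_irr (sorted_enum_ord_set _)) => [|x].
  apply: (map_sorted (fun i => k <= i)%N) => [i j Hi Hj lt_ij||].
  - by apply: s_gr => //; rewrite (Hi : (k <= i)%N) orbT.
  - by apply/allP=> i; rewrite mem_drop_ord.
  - exact: drop_sorted.
rewrite mem_enum inE -[x](permKV s) mem_S mem_map; last exact: perm_inj.
by rewrite mem_drop_ord -leqNgt.
Qed.

Lemma sum_grassmannian q k : (k <= n)%N ->
  (\sum_(s : 'S_n | grassmannian k s) q ^ inv s =
     \sum_(S : {set 'I_n} | #|S| == k) q ^ set_inv S)%N.
Proof.
move=> le_kn; have [f [f_gr f_im]] := exists_grassmannian_perm le_kn.
rewrite (reindex_onto f (initial_image k)) => [|s]; last exact: f_im.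
apply: eq_big => [S|S /andP[gr /eqP im]].
  apply/andP/eqP=> [[_ /eqP<-]|/f_gr[-> ->]] //; exact: card_initial_image.
by rewrite (inv_grassmannian gr) im.
Qed.
End Grassmannian.

Section SetInversions.

Lemma set_inv_lift n (S : {set 'I_n}) :
  set_inv (lift ord_max @: S) = set_inv S.
Proof.
pose f (xy : 'I_n * 'I_n) := (lift ord_max xy.1, lift ord_max xy.2).
have lift_injn : injective (lift (@ord_max n)) by exact: lift_inj.
have f_inj : injective f.
  move=> [x y] [x' y'] e; have /lift_injn/= -> := congr1 fst e.
  by have /lift_injn/= -> := congr1 snd e.
rewrite /set_inv -(card_imset _ f_inj); apply: eq_card => -[x y]; rewrite !inE /=.
apply/and3P/imsetP => [[/imsetP[x' Sx' ->]] |[[x' y']]].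
  case: (unliftP ord_max y) => [y' ->|->].
    rewrite mem_imset // => nSy'; rewrite !lift_max => lt_yx.
    by exists (x', y'); rewrite ?inE ?Sx' ?nSy'.
  by rewrite lift_max /= ltnNge ltnW.
by rewrite inE /= => /and3P[Sx Sy lt_yx] [-> ->]; rewrite !lift_max !mem_imset.
Qed.

(** The greatest element forms an inversion with each element outside of the
    set. *)
Lemma set_inv_lift_max n (S : {set 'I_n}) :
  set_inv (ord_max |: lift ord_max @: S) = (n - #|S| + set_inv S)%N.
Proof.
pose f (xy : 'I_n * 'I_n) := (lift ord_max xy.1, lift ord_max xy.2).
pose g (y : 'I_n) := (@ord_max n, lift ord_max y).
have lift_injn : injective (lift (@ord_max n)) by exact: lift_inj.
have f_inj : injective f.
  move=> [x y] [x' y'] e; have /lift_injn/= -> := congr1 fst e.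
  by have /lift_injn/= -> := congr1 snd e.
have g_inj : injective g by move=> y y' /(congr1 snd)/lift_injn.
have max_lift y : (lift (@ord_max n) y == ord_max) = false.
  by apply/negbTE; rewrite eq_sym neq_lift.
have -> : (n - #|S| = #|~: S|)%N by rewrite [RHS]cardsCs setCK card_ord.
rewrite -(card_imset _ g_inj).
rewrite {2}/set_inv -(card_imset _ f_inj) -cardsUI.
rewrite [X in (_ + X)%N](_ : _ = 0%N) ?addn0; last first.
  apply/eqP; rewrite cards_eq0 -subset0; apply/subsetP=> xy.
  rewrite inE => /andP[/imsetP[y _ ->] /imsetP[[x' y'] _ /(congr1 fst)/eqP]].
  by rewrite eq_sym max_lift.
have bumpE (y : 'I_n) : bump n y = y by rewrite /bump leqNgt ltn_ord.
apply: eq_card => -[x y]; rewrite !inE /=.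
apply/and3P/orP => [[]|].
  case: (unliftP ord_max y) => [y' ->|->]; last by rewrite eqxx.
  rewrite max_lift /= mem_imset //.
  case: (unliftP ord_max x) => [x' ->|->].
    rewrite max_lift /= mem_imset // => Sx' Sy' lt_yx; right.
    by apply/imsetP; exists (x', y'); rewrite ?inE ?Sx' ?Sy' //= -(bumpE x') -(bumpE y').
  by move=> _ Sy' _; left; apply/imsetP; exists y'; rewrite ?inE.
case=> /imsetP[].
  move=> y'; rewrite inE => Sy' [-> ->]; rewrite eqxx max_lift /= mem_imset //.
  by rewrite bumpE ltn_ord.
move=> [x' y']; rewrite inE /= => /and3P[Sx Sy lt_yx] [-> ->].
by rewrite !max_lift /= !bumpE !mem_imset // Sx.
Qed.

Lemma sum_set_inv q n k :
  (\sum_(S : {set 'I_n} | #|S| == k) q ^ set_inv S = qbinom q n k)%N.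
Proof.
elim: n k => [|n IHn] k.
  have set_eq (S : {set 'I_0}) : S = set0 by apply/setP=> -[].
  case: k => [|k]; last first.
    by rewrite big_pred0 // => S; rewrite (set_eq S) cards0.
  rewrite (big_pred1 set0) => [|S]; last by rewrite (set_eq S) /= cards0 !eqxx.
  rewrite (_ : set_inv _ = 0%N) //; apply/eqP; rewrite cards_eq0 -subset0.
  by apply/subsetP=> -[[]].
have lift_injn : injective (lift (@ord_max n)) by exact: lift_inj.
pose down (S : {set 'I_n.+1}) := lift ord_max @^-1: S.
have downK (S : {set 'I_n}) : down (lift ord_max @: S) = S.
  by apply/setP=> i; rewrite inE mem_imset.
have downU (S : {set 'I_n}) : down (ord_max |: lift ord_max @: S) = S.
  by apply/setP=> i; rewrite !inE mem_imset // eq_sym (negbTE (neq_lift _ _)).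
have max_notin (S : {set 'I_n}) : (@ord_max n \in lift ord_max @: S) = false.
  by apply/negbTE/imsetP=> -[i _ /eqP]; rewrite (negbTE (neq_lift _ _)).
have upK (S : {set 'I_n.+1}) : ord_max \notin S -> lift ord_max @: down S = S.
  move=> nS; apply/setP=> i; case: (unliftP ord_max i) => [j ->|->].
    by rewrite mem_imset // inE.
  by rewrite max_notin (negbTE nS).
have upU (S : {set 'I_n.+1}) : ord_max \in S -> ord_max |: lift ord_max @: down S = S.
  move=> mS; apply/setP=> i; rewrite !inE; case: (unliftP ord_max i) => [j ->|->].
    by rewrite mem_imset // inE eq_sym (negbTE (neq_lift _ _)).
  by rewrite eqxx mS.
rewrite (bigID (fun S : {set 'I_n.+1} => ord_max \notin S)) /=.
rewrite (reindex_onto (fun S : {set 'I_n} => lift ord_max @: S) down) /=; last first.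
  by move=> S /andP[_ /upK].
under eq_bigl do rewrite downK eqxx max_notin /= !andbT card_imset //.
under eq_bigr do rewrite set_inv_lift.
rewrite IHn.
rewrite (reindex_onto (fun S : {set 'I_n} => ord_max |: lift ord_max @: S) down) /=; last first.
  by move=> S /andP[_ /negbNE/upU].
under eq_bigl do
  rewrite downU eqxx setU11 /= !andbT cardsU1 max_notin card_imset //= add1n.
under eq_bigr => S cS do rewrite set_inv_lift_max expnD.
case: k => [|k]; first by rewrite big_pred0 // addn0; case: (n).
rewrite /= -(IHn k) big_distrr /=; congr (_ + _)%N; apply: eq_bigr => S.
by rewrite eqSS => /eqP->.
Qed.

Lemma des_inv_sum_qbinom q n :
  des_inv_sum q n = (\sum_(k < n.+1) qbinom q n k)%N.
Proof.
under eq_bigr => k _ do rewrite -sum_set_inv -sum_grassmannian -1?ltnS //.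
rewrite (exchange_big_dep xpredT) //= /des_inv_sum big_mkcond /=.
apply: eq_bigr => s _; rewrite sum_nat_const.
have := card_grassmannian s; rewrite cardsE => ->.
by case: ifP => _; rewrite ?mul1n ?mul0n.
Qed.

End SetInversions.

(** * The number of subspaces of F^n *)

Section SubspaceTotals.
Variables (F : finFieldType) (n : nat).
Local Notation V := 'rV[F]_n.
Local Notation q := #|F|.

Lemma card_finField_gt1 : (1 < q)%N.
Proof. exact: finNzRing_gt1. Qed.

Lemma dim_rowspace : \dim {:V} = n.
Proof. by rewrite dimvf /dim /= mul1n. Qed.

Lemma card_subspaces_dim k :
  #|subspaces_between 0 {:V} k| = qbinom q n k.
Proof.
have q_gt1 := card_finField_gt1.
have dim0 : (\dim (0 : {vspace V}) <= k)%N by rewrite dimv0.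
have /eqP := card_subspaces_between (sub0v {:V}) dim0.
rewrite dimv0 dim_rowspace !big_mkord -(qbinom_prod n k) ?(ltnW q_gt1) //.
rewrite eqn_pmul2r => [/eqP //|].
by apply: prodn_gt0 => i; rewrite subn_gt0 ltn_exp2l.
Qed.

Lemma card_subspaces : #|{: {vspace V}}| = des_inv_sum q n.
Proof.
rewrite des_inv_sum_qbinom -sum1_card.
have lt_dim (U : {vspace V}) : (\dim U < n.+1)%N.
  by rewrite ltnS -[X in (_ <= X)%N]dim_rowspace dimvS ?subvf.
rewrite (partition_big (fun U : {vspace V} => Ordinal (lt_dim U)) xpredT) //=.
apply: eq_bigr => k _; rewrite -card_subspaces_dim -sum1_card.
by apply: eq_bigl => U; rewrite inE sub0v subvf -val_eqE.
Qed.

(** The middle Gaussian binomial suffices: each of the k factors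
    (q^n - q^i) / (q^k - q^i) is at least q^(n-k). *)
Lemma card_subspaces_ge : (q ^ (n ^ 2 %/ 4) <= #|{: {vspace V}}|)%N.
Proof.
have q_gt1 := card_finField_gt1.
rewrite card_subspaces des_inv_sum_qbinom.
have [k le_kn ->] : exists2 k, (k <= n)%N & (n ^ 2 %/ 4 = (n - k) * k)%N.
  exists n./2; first by lia.
  have := odd_double_half n; move: (n./2) => h; case: (odd n) => <-; rewrite -muln2 /=.
    have -> : ((1 + h * 2) ^ 2 = (1 + h * 2 - h) * h * 4 + 1)%N by nia.
    by rewrite divnMDl // addn0.
  have -> : ((0 + h * 2) ^ 2 = (0 + h * 2 - h) * h * 4)%N by nia.
  by rewrite mulnK.
rewrite (bigD1 (inord k)) //= inordK ?ltnS //; apply: leq_trans (leq_addr _ _).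
have P_gt0 : (0 < \prod_(i < k) (q ^ k - q ^ i))%N.
  by apply: prodn_gt0 => i; rewrite subn_gt0 ltn_exp2l.
rewrite -(leq_pmul2r P_gt0) qbinom_prod ?(ltnW q_gt1) // expnM.
rewrite -[in X in (X * _)%N](card_ord k) -prod_nat_const -big_split /=.
apply: leq_prod => i _; rewrite mulnBr -expnD card_ord subnK // leq_sub2l //.
by rewrite leq_pmull // expn_gt0 (ltnW q_gt1).
Qed.

End SubspaceTotals.

(** * Invariant subspaces of a semilinear map *)

Section SemilinearInvariant.
Variables (F : finFieldType) (n : nat).
Local Notation V := 'rV[F]_n.
Implicit Types (U X W : {vspace V}) (u v : V).

Variables (sigma : F -> F) (g : V -> V).
Hypotheses (gD : forall u v, g (u + v) = g u + g v)
           (gZ : forall c u, g (c *: u) = sigma c *: g u) (g_inj : injective g).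

(** For a semilinear g this is the F-span of g(X); it is given by a basis since g
    itself need not be F-linear. *)
Definition image_span X : {vspace V} := <<[seq g u | u <- vbasis X]>>%VS.

Lemma semilinear0 : g 0 = 0.
Proof. by apply: (addrI (g 0)); rewrite -gD !addr0. Qed.

Lemma mem_image_span X u : u \in X -> g u \in image_span X.
Proof.
move/coord_vbasis->; elim/big_ind: _ => [|v w|i _].
- by rewrite semilinear0 mem0v.
- by rewrite gD; apply: memvD.
by rewrite gZ memvZ // memv_span // map_f // mem_nth // size_tuple.
Qed.

Lemma image_span_sub X U : (X <= U)%VS -> {in U, forall u, g u \in U} ->
  (image_span X <= U)%VS.
Proof.
move=> sXU invU; apply/span_subvP=> _ /mapP[u Xu ->].
by apply/invU/(subvP sXU)/vbasis_mem.
Qed.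

Lemma dim_image_span X : (\dim (image_span X) <= \dim X)%N.
Proof. by apply: leq_trans (dim_span _) _; rewrite size_map size_tuple. Qed.

(** A map that fixes all lines is a scalar, here modulo W and without assuming W
    invariant.  Comparing g u, g v and g (u + v) shows that vectors u, v
    independent modulo W have the same multiplier; a fixed independent pair
    u0, u1 then transfers the multiplier to all of U.  It is nonzero, as
    otherwise g would map U injectively into the smaller W, and comparing
    g (c u0) with c u0 makes sigma trivial. *)
Lemma scalar_modulo U W : {in U, forall u, g u \in U} -> (W <= U)%VS ->
    (\dim W + 2 <= \dim U)%N ->
    {in U, forall u, u \notin W -> g u \in (W + <[u]>)%VS} ->
  exists2 lam, {in U, forall u, g u - lam *: u \in W} & sigma =1 id.
Proof.
move=> invU sWU dimW H.
have scal u : u \in U -> u \notin W -> exists lam, g u - lam *: u \in W.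
  move=> Uu nWu; have /memv_addP[w Ww [_ /vlineP[c ->] ->]] := H u Uu nWu.
  by exists c; rewrite addrK.
have same u v lam : u \in U -> u \notin W -> v \in U -> v \notin (W + <[u]>)%VS ->
    g u - lam *: u \in W -> g v - lam *: v \in W.
  move=> Uu nWu Uv nv gu.
  have nWv : v \notin W by apply: contra nv; apply/subvP/addvSl.
  have nWuv : u + v \notin W.
    apply: contra nv => Wuv; have -> : v = (u + v) + - u by rewrite addrC addKr.
    by rewrite memv_add // memvN memv_line.
  have [lam' gv] := scal v Uv nWv.
  have [mu guv] := scal (u + v) (memvD Uu Uv) nWuv.
  have key : (mu - lam) *: u + (mu - lam') *: v \in W.
    have -> : (mu - lam) *: u + (mu - lam') *: v =
        (g u - lam *: u) + (g v - lam' *: v) - (g (u + v) - mu *: (u + v)).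
      by rewrite gD; apply/rowP=> i; rewrite !mxE; ring.
    by apply: memvB guv; apply: memvD.
  have eq_mu' : mu = lam'.
    apply/eqP; rewrite -subr_eq0; apply: contraNT nv => ne.
    have -> : v = (mu - lam')^-1 *: ((mu - lam) *: u + (mu - lam') *: v)
                  + - (((mu - lam')^-1 * (mu - lam)) *: u).
      by rewrite scalerDr !scalerA mulVf // scale1r addrC addKr.
    by rewrite memv_add ?memvZ // memvN memvZ ?memv_line.
  have eq_mu : mu = lam.
    apply/eqP; rewrite -subr_eq0; move: key; rewrite eq_mu' subrr scale0r addr0 -eq_mu'.
    by rewrite rpredZeq (negbTE nWu) orbF.
  by rewrite -eq_mu eq_mu'.
have /subvPn[u0 Uu0 nWu0] : ~~ (U <= W)%VS.
  by apply: contraTN dimW => /dimvS; lia.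
have /subvPn[u1 Uu1 nWu1] : ~~ (U <= W + <[u0]>)%VS.
  by apply: contraTN dimW => /dimvS; rewrite dimv_add_line //; lia.
have [lam gu0] := scal u0 Uu0 nWu0; have gu1 := same _ _ _ Uu0 nWu0 Uu1 nWu1 gu0.
have gW : {in U, forall u, g u - lam *: u \in W}.
  move=> u Uu; have [Wu|] := boolP (u \in (W + <[u0]>)%VS); last first.
    by move=> nu; apply: same Uu0 nWu0 Uu nu gu0.
  have nuu1 : u + u1 \notin (W + <[u0]>)%VS.
    by apply: contra nWu1 => Wuu1; rewrite -[u1](addKr u) memvD ?memvN.
  have guu1 := same _ _ _ Uu0 nWu0 (memvD Uu Uu1) nuu1 gu0.
  rewrite -[_ - _](addrK (g u1 - lam *: u1)); apply: memvB => //.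
  by rewrite addrACA -opprD -scalerDr -gD.
exists lam => // c.
have lam_neq0 : lam != 0.
  apply: contraTneq dimW => lam0; rewrite -ltnNge.
  suff : (#|U| <= #|W|)%N.
    rewrite !card_vspace leq_exp2l; last exact: finNzRing_gt1.
    by move=> le_UW; rewrite addn2 ltnS leqW.
  rewrite -(card_imset U g_inj); apply/subset_leq_card/subsetP=> _ /imsetP[u Uu ->].
  by have := gW u Uu; rewrite lam0 scale0r subr0.
have : (lam * (c - sigma c)) *: u0 \in W.
  have -> : (lam * (c - sigma c)) *: u0 =
      sigma c *: (g u0 - lam *: u0) - (g (c *: u0) - lam *: (c *: u0)).
    by rewrite gZ; apply/rowP=> i; rewrite !mxE; ring.
  by apply: memvB; [apply: memvZ | apply: gW; apply: memvZ].
rewrite rpredZeq (negbTE nWu0) orbF mulf_eq0 (negbTE lam_neq0) subr_eq0.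
by move/eqP.
Qed.

(** Greedy choice: as long as some u in U has u and g u independent modulo the
    span W of the pairs chosen before, one adds it.  When there is none, each
    g u lies in W + <u>, the situation of [scalar_modulo]. *)
Lemma free_pairs_or_scalar U m : {in U, forall u, g u \in U} -> (2 * m <= \dim U)%N ->
  (exists X, [/\ (X <= U)%VS, \dim X = m & \dim (X + image_span X) = (2 * m)%N]) \/
  (exists lam W, [/\ (\dim W < 2 * m)%N, {in U, forall u, g u - lam *: u \in W}
                   & sigma =1 id]).
Proof.
move=> invU; elim: m => [|m IHm] dimU.
  left; exists 0%VS; rewrite sub0v dimv0; split=> //; apply/eqP.
  by rewrite add0v muln0 -leqn0 (leq_trans (dim_image_span _)) ?dimv0.
have [|[X [sXU dX dXX]]|[lam [W [dW gW sg1]]]] := IHm; first by lia.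
  2: by right; exists lam, W; split=> //; lia.
set W := (X + image_span X)%VS in dXX.
have sWU : (W <= U)%VS by rewrite subv_add sXU image_span_sub.
have [/existsP[u /and3P[Uu nWu nWgu]]|/existsPn none] := boolP
    [exists u, [&& u \in U, u \notin W & g u \notin (W + <[u]>)%VS]].
  left; exists (X + <[u]>)%VS.
  have nXu : u \notin X by apply: contra nWu; apply/subvP/addvSl.
  have dXu : \dim (X + <[u]>) = m.+1 by rewrite dimv_add_line ?dX.
  split=> //; first by rewrite subv_add sXU -memvE.
  apply/eqP; rewrite eqn_leq; apply/andP; split.
    apply: leq_trans (dimv_add_leqif _ _) _.
    by have := dim_image_span (X + <[u]>); rewrite dXu; lia.
  have -> : (2 * m.+1 = \dim (W + <[u]> + <[g u]>))%N.
    by rewrite !dimv_add_line // dXX mulnS.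
  apply: dimvS; rewrite !subv_add.
  rewrite (subv_trans (addvSl _ _) (addvSl _ _)) (subv_trans (addvSr _ _) (addvSl _ _)).
  rewrite -[(<[g u]> <= _)%VS]memvE.
  rewrite (subvP (addvSr _ _)) ?mem_image_span ?andbT //; last first.
    by rewrite (subvP (addvSr _ _)) ?memv_line.
  apply/span_subvP=> _ /mapP[v Xv ->].
  rewrite (subvP (addvSr _ _)) // mem_image_span // (subvP (addvSl _ _)) //.
  exact: vbasis_mem.
right; have dimWU : (\dim W + 2 <= \dim U)%N by rewrite dXX; lia.
have [|lam gW sg1] := scalar_modulo invU sWU dimWU.
  by move=> u Uu nWu; have := none u; rewrite Uu nWu /= negbK.
by exists lam, W; split=> //; rewrite dXX; lia.
Qed.

(** The m independent pairs make half of a 2m-dimensional subspace redundant: U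
    is recovered from its (dim U - m)-dimensional subspace X by applying g.  So
    there are at most as many such U as there are subspaces X. *)
Lemma invariant_generated_or_scalar U m : {in U, forall u, g u \in U} -> (2 * m <= \dim U)%N ->
  (exists2 X, \dim X = (\dim U - m)%N & U = (X + image_span X)%VS) \/
  (exists lam W, [/\ (\dim W < 2 * m)%N, {in U, forall u, g u - lam *: u \in W}
                   & sigma =1 id]).
Proof.
move=> invU dimU; have [[X [sXU dX dXX]]|] := free_pairs_or_scalar invU dimU; last by right.
left; set W := (X + image_span X)%VS in dXX.
have sWU : (W <= U)%VS by rewrite subv_add sXU image_span_sub.
have dY : \dim (U :\: W) = (\dim U - 2 * m)%N.
  by have := dimv_cap_compl U W; rewrite (capv_idPr sWU) dXX; lia.
exists (X + (U :\: W))%VS.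
  rewrite dimv_disjoint_sum ?dX ?dY; first by lia.
  apply/eqP; rewrite -subv0 -(capv_diff U W) capvC capvS //.
  exact: addvSl.
apply/eqP; rewrite eqEsubv; apply/andP; split; last first.
  have sYU : (X + (U :\: W) <= U)%VS by rewrite subv_add sXU diffvSl.
  by rewrite subv_add sYU image_span_sub.
rewrite -{1}(addv_diff_cap U W) (capv_idPr sWU) subv_add.
rewrite (subv_trans (addvSr _ _) (addvSl _ _)) subv_add.
rewrite (subv_trans (addvSl _ _) (addvSl _ _)) /=.
apply/span_subvP=> _ /mapP[v Xv ->].
rewrite (subvP (addvSr _ _)) // mem_image_span // (subvP (addvSl _ _)) //.
exact: vbasis_mem.
Qed.
End SemilinearInvariant.

(** * Exponents *)

Section NumericBounds.
Local Open Scope nat_scope.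

(** From 4 k (n - k) = n^2 - (n - 2 k)^2. *)
Lemma exponent_off_center n k m x : k <= n -> m + 2 * k <= n \/ m + n <= 2 * k ->
  4 * x <= m ^ 2 -> (n - k) * k + x <= n ^ 2 %/ 4.
Proof.
rewrite leq_divRL // => le_kn off le_x.
have {le_kn} [a def_n] : exists a, n = k + a by exists (n - k); lia.
rewrite {n}def_n addKn in off *; case: off => off.
  have [e ->] : exists e, a = m + k + e by exists (a - m - k); lia.
  nia.
have [e ->] : exists e, k = m + a + e by exists (k - m - a); lia.
nia.
Qed.

(** For a kernel of dimension D = n - r, the first two terms add up to
    k (n - k) - (k - b) (r - b). *)
Lemma exponent_kernel n k b r D x : D + r = n -> k - b <= D -> b <= k -> b <= r -> k <= n ->
  x <= (k - b) * (r - b) -> (D - (k - b)) * (k - b) + (n - k) * (k - (k - b)) + x <= n ^ 2 %/ 4.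
Proof.
move=> <- le_D le_bk le_br le_kn; rewrite leq_divRL // subKn //.
have [c def_k] : exists c, k = c + b by exists (k - b); lia.
have [e def_r] : exists e, r = e + b by exists (r - b); lia.
subst k r; rewrite !addnK in le_D * => le_x.
have [f def_D] : exists f, D = f + c by exists (D - c); lia.
subst D; rewrite addnK.
have -> : f + c + (e + b) - (c + b) = f + e by lia.
apply: (@leq_trans (((f + e) * (c + b)) * 4)); first by nia.
have -> : f + c + (e + b) = (f + e) + (c + b) by lia.
by rewrite mulnC nat_AGM2.
Qed.

(** For an image of dimension r, the first two terms add up to
    k (n - k) - b (n - k - r + b). *)
Lemma exponent_image n k b r x : b <= r -> b <= k -> k <= n -> r + k <= n + b ->
  x <= b * (n + b - (k + r)) -> (r - b) * b + (n - k) * (k - b) + x <= n ^ 2 %/ 4.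
Proof.
move=> le_br le_bk le_kn le_rk; rewrite leq_divRL //.
have [c def_k] : exists c, k = c + b by exists (k - b); lia.
have [e def_r] : exists e, r = e + b by exists (r - b); lia.
subst k r; rewrite !addnK.
have [f def_n] : exists f, n = f + (c + b) + e by exists (n - (c + b) - e); lia.
subst n.
have -> : f + (c + b) + e + b - (c + b + (e + b)) = f by lia.
have -> : f + (c + b) + e - (c + b) = f + e by lia.
move=> le_x; have -> : f + (c + b) + e = (f + e) + (c + b) by lia.
apply: (@leq_trans (((f + e) * (c + b)) * 4)); first by nia.
by rewrite mulnC nat_AGM2.
Qed.

(** The saving m^2 / 4 available for m = n / 64 covers n s, the largest one ever
    asked for.  Without rounding, m^2 / 4 would be at least 2 n s, since
    128 * 256 = 8 * 64^2; this factor 2 absorbs the rounding of m. *)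
Lemma saving_le_sqr n s : 128 * (256 * s) <= n -> 4 * (n * s) <= (n %/ 64) ^ 2.
Proof.
have [-> _|s_gt0 le_sn] := posnP s; first by rewrite muln0.
have := divn_eq n 64; have := @ltn_pmod n 64 isT; move: (n %/ 64) (n %% 64) => m u.
by move=> lt_u def_n; have : 512 <= m; [lia | nia].
Qed.

Lemma central_dims n k : ~~ (n %/ 64 + 2 * k <= n) -> ~~ (n %/ 64 + n <= 2 * k) ->
  63 * n <= 128 * k <= 65 * n.
Proof. lia. Qed.
End NumericBounds.

(** * Subspaces that meet a fixed subspace, and the rank of a monomial map minus a scalar *)

Lemma card_bigcup_le (I T : finType) (P : pred I) (S : I -> {set T}) :
  (#|\bigcup_(i | P i) S i| <= \sum_(i | P i) #|S i|)%N.
Proof.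
apply: (big_ind2 (fun (A : {set T}) m => #|A| <= m)%N); rewrite ?cards0 //.
move=> A1 m1 A2 m2 le1 le2; apply: leq_trans (leq_card_setU _ _) _.
exact: leq_add.
Qed.

Section FlagCount.
Variables (F : finFieldType) (n : nat).
Local Notation V := 'rV[F]_n.
Local Notation q := #|F|.
Implicit Types (A E U : {vspace V}).

(** The dimension condition is on some subspace of both U and E, not on their
    intersection: this is what the count by flags A <= U controls. *)
Definition subspaces_meeting E j k :=
  [set U | (\dim U == k) && [exists A, [&& (A <= E)%VS, (A <= U)%VS & \dim A == j]]].

Lemma card_subspaces_meeting E j k : (j <= k)%N -> (k <= n)%N ->
  (#|subspaces_meeting E j k|
     <= n.+1 ^ 2 * q ^ ((\dim E - j) * j + (n - k) * (k - j)))%N.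
Proof.
move=> le_jk le_kn.
have sub : subspaces_meeting E j k \subset
    \bigcup_(A in subspaces_between 0 E j) subspaces_between A {:V} k.
  apply/subsetP=> U; rewrite inE => /andP[dU /existsP[A /and3P[sAE sAU dA]]].
  apply/bigcupP; exists A; first by rewrite inE sub0v sAE dA.
  by rewrite inE sAU subvf dU.
apply: leq_trans (subset_leq_card sub) _.
apply: (@leq_trans (\sum_(A in subspaces_between 0 E j) #|subspaces_between A {:V} k|)).
  exact: card_bigcup_le.
apply: (@leq_trans (\sum_(A in subspaces_between 0 E j) n.+1 * q ^ ((n - k) * (k - j)))).
  apply: leq_sum => A; rewrite inE => /and3P[_ _ /eqP dA].
  apply: leq_trans (card_subspaces_between_le _ _) _; rewrite dA //.
  by rewrite dim_rowspace leq_mul2r ltnS (leq_trans (leq_subr _ _)) ?orbT.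
rewrite sum_nat_const expnD expnS expn1.
have dim0 : (\dim (0 : {vspace V}) <= j)%N by rewrite dimv0.
have := card_subspaces_between_le E dim0; rewrite dimv0 subn0 => le_j.
have {}le_j : (#|subspaces_between 0 E j| <= n.+1 * q ^ ((\dim E - j) * j))%N.
  by apply: leq_trans le_j _; rewrite leq_mul2r ltnS (leq_trans le_jk) ?orbT.
by apply: leq_trans (leq_mul le_j (leqnn _)) _; apply/eq_leq; ring.
Qed.

Lemma card_subspaces_dim_le k : (k <= n)%N ->
  (#|[set U : {vspace V} | \dim U == k]| <= n.+1 * q ^ ((n - k) * k))%N.
Proof.
move=> le_kn; have dim0 : (\dim (0 : {vspace V}) <= k)%N by rewrite dimv0.
have := card_subspaces_between_le {:V} dim0; rewrite dimv0 subn0 dim_rowspace => le_k.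
have -> : [set U : {vspace V} | \dim U == k] = subspaces_between 0 {:V} k.
  by apply/setP=> U; rewrite !inE sub0v subvf.
by apply: leq_trans le_k _; rewrite leq_mul2r ltnS le_kn orbT.
Qed.

(** Restriction to the coordinates in J embeds U into F^J. *)
Lemma dim_le_coords U (J : {set 'I_n}) :
  (forall u, u \in U -> (forall i, i \in J -> u 0 i = 0) -> u = 0) ->
  (\dim U <= #|J|)%N.
Proof.
move=> H; rewrite -(leq_exp2l _ _ (card_finField_gt1 F)) -card_vspace.
pose f (u : V) := [ffun i : {i | i \in J} => u 0 (val i)].
have f_inj : {in U &, injective f}.
  move=> u v Uu Uv /ffunP eq_f; apply/eqP; rewrite -subr_eq0; apply/eqP.
  apply: H => [|i Ji]; first exact: memvB.
  by have := eq_f (exist _ i Ji); rewrite !ffunE !mxE /= => ->; rewrite subrr.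
rewrite -(card_in_imset f_inj); apply: leq_trans (max_card _) _.
by rewrite card_ffun card_sig.
Qed.
End FlagCount.

Section MonomialMaps.
Variables (F : finFieldType) (n : nat).
Local Notation V := 'rV[F]_n.
Local Notation q := #|F|.
Implicit Types (U : {vspace V}) (d : V) (s : 'S_n) (lam : F).

Definition monomial_act (sigma : F -> F) d s (u : V) : V :=
  map_mx sigma u *m (diag_mx d *m perm_mx s).

Lemma monomial_actE sigma d s u i :
  monomial_act sigma d s u 0 (s i) = sigma (u 0 i) * d 0 i.
Proof.
rewrite /monomial_act mulmxA mul_mx_diag mxE (bigD1 i) //= !mxE eqxx mulr1.
rewrite big1 ?addr0 // => j ne_ji.
by rewrite !mxE (inj_eq perm_inj) (negbTE ne_ji) mulr0.
Qed.

Definition defect lam d s : {set 'I_n} := [set i | ~~ ((s i == i) && (d 0 i == lam))].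

(** Thus lam = 0 serves for all maps that are far from every scalar. *)
Lemma defect0 d s : (forall i, d 0 i != 0) -> defect 0 d s = setT.
Proof. by move=> nz_d; apply/setP=> i; rewrite !inE (negbTE (nz_d i)) andbF. Qed.

Definition shifted lam d s : 'End(V) :=
  linfun (mulmxr (diag_mx d *m perm_mx s - lam%:M)).

Lemma shiftedE lam d s u : shifted lam d s u = monomial_act id d s u - lam *: u.
Proof. by rewrite lfunE /= mulmxBr mul_mx_scalar /monomial_act map_mx_id. Qed.

Lemma shiftedEi lam d s u i :
  shifted lam d s u 0 (s i) = u 0 i * d 0 i - lam * u 0 (s i).
Proof. by rewrite shiftedE mxE monomial_actE 2!mxE. Qed.

Lemma rank_shifted_le lam d s : (\dim (limg (shifted lam d s)) <= #|defect lam d s|)%N.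
Proof.
apply: dim_le_coords => _ /memv_imgP[u _ ->] H; apply/rowP=> i; rewrite [RHS]mxE.
have [/H //|] := boolP (i \in defect lam d s).
rewrite inE negbK => /andP[/eqP fix_i /eqP d_i].
by rewrite -{1}fix_i shiftedEi fix_i d_i mulrC subrr.
Qed.

(** A set J, maximal among those with no point moved into J itself: each element
    of the defect then lies in J, in s(J) or in the preimage of J, since it
    could be added to J otherwise. *)
Lemma exists_sparse_defect lam d s : exists J : {set 'I_n},
  [/\ J \subset defect lam d s, (#|defect lam d s| <= 3 * #|J|)%N
    & forall i, i \in J -> s i != i -> s i \notin J].
Proof.
pose P (J : {set 'I_n}) := (J \subset defect lam d s) &&
  [forall i in J, (s i != i) ==> (s i \notin J)].
have P0 : P set0 by rewrite /P sub0set; apply/forall_inP=> i; rewrite inE.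
have [J /maxsetP[/andP[sJT /forall_inP JP] maxJ] _] := maxset_exists P0.
exists J; split=> // [|i Ji]; last by move/implyP: (JP i Ji).
have s_inj : injective s by exact: perm_inj.
have sub : defect lam d s \subset J :|: (s @: J) :|: (s @^-1: J).
  apply/subsetP=> i Ti; rewrite !inE -orbA; apply: contraT.
  rewrite !negb_or => /and3P[nJi nsJ nJs].
  suff PJi : P (i |: J) by rewrite -(maxJ _ PJi) ?setU11 ?subsetUr in nJi.
  rewrite /P subUset sub1set Ti sJT /=; apply/forall_inP=> j.
  rewrite !inE negb_or => /orP[/eqP->|Jj]; apply/implyP=> ne; first by rewrite ne.
  rewrite (implyP (JP j Jj) ne) andbT.
  by apply: contraNneq nsJ => <-; apply: imset_f.
apply: leq_trans (subset_leq_card sub) _.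
apply: leq_trans (leq_card_setU _ _) _.
have -> : #|s @^-1: J| = #|J|.
  by rewrite on_card_preimset //; apply: onW_bij; exists (s^-1%g) => i; rewrite ?permK ?permKV.
by have [+ _] := leq_card_setU J (s @: J); rewrite card_imset //; lia.
Qed.

(** A vector u killed by g - lam that vanishes off the sparse set J is 0.  At a
    fixed i in J this is because d_i <> lam; at a moved one because s i is
    outside of J, whence d_i u_i = lam u_(s i) = 0.  So the kernel embeds into
    the coordinates outside of J. *)
Lemma defect_le_rank lam d s : (forall i, d 0 i != 0) ->
  (#|defect lam d s| <= 3 * \dim (limg (shifted lam d s)))%N.
Proof.
move=> nz_d; have [J [sJT leT JP]] := exists_sparse_defect lam d s.
apply: leq_trans leT _; rewrite leq_pmul2l //.
have dimK := limg_ker_dim (shifted lam d s) {:V}; rewrite capfv dim_rowspace in dimK.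
have : (\dim (lker (shifted lam d s)) <= #|~: J|)%N.
  apply: dim_le_coords => u Ku u0; apply/rowP=> i; rewrite [RHS]mxE.
  have [Ji|] := boolP (i \in J); last by move=> nJi; apply: u0; rewrite inE.
  move: Ku; rewrite memv_ker => /eqP/rowP/(_ (s i)); rewrite shiftedEi [RHS]mxE.
  have [fix_i|ne] := eqVneq (s i) i.
    move: (subsetP sJT i Ji); rewrite inE fix_i eqxx /= => ne_d /eqP.
    rewrite mulrC -mulrBl mulf_eq0 subr_eq0 (negbTE ne_d) /=.
    by move/eqP.
  rewrite (u0 (s i)) ?inE ?JP // mulr0 subr0 => /eqP.
  by rewrite mulf_eq0 (negbTE (nz_d i)) orbF => /eqP.
move=> le_K; have := cardsC J; rewrite card_ord.
move=> def_n; rewrite -(leq_add2r #|~: J|) [X in (X <= _)%N]def_n.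
by rewrite -[X in (X <= _)%N]dimK addnC leq_add2l.
Qed.
End MonomialMaps.

(** * Few subspaces are invariant under a nonscalar monomial map *)

Section InvariantCount.
Variables (F : finFieldType) (n : nat).
Local Notation V := 'rV[F]_n.
Local Notation q := #|F|.
Implicit Types (E U : {vspace V}).

Definition invariant_subspaces (g : V -> V) : {set {vspace V}} :=
  [set U : {vspace V} | [forall u : V, (u \in U) ==> (g u \in U)]].

Lemma invariant_subspacesP g U :
  reflect {in U, forall u, g u \in U} (U \in invariant_subspaces g).
Proof.
by rewrite inE; apply: (iffP forallP) => H u; [apply/implyP/H | apply/implyP/H].
Qed.

Lemma subspaces_meeting_small E j k : (\dim E < j)%N -> subspaces_meeting E j k = set0.
Proof.
move=> lt_j; apply/setP=> U; rewrite !inE; apply/negP=> /andP[_ /existsP[A]].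
by case/and3P=> /dimvS + _ /eqP dA; rewrite dA leqNgt lt_j.
Qed.

Lemma card_meeting_kernel (h : 'End(V)) b k x :
    (b <= k)%N -> (k <= n)%N -> (b <= \dim (limg h))%N ->
    (x <= (k - b) * (\dim (limg h) - b))%N ->
  (#|subspaces_meeting (lker h) (k - b)%N k| * q ^ x <= n.+1 ^ 2 * q ^ (n ^ 2 %/ 4))%N.
Proof.
move=> le_bk le_kn le_br le_x.
have [lt_D|le_D] := ltnP (\dim (lker h)) (k - b).
  by rewrite subspaces_meeting_small // cards0.
have dimK := limg_ker_dim h {:V}; rewrite capfv dim_rowspace in dimK.
apply: leq_trans (leq_mul (card_subspaces_meeting _ (leq_subr _ _) le_kn) (leqnn _)) _.
rewrite -mulnA -expnD leq_mul2l leq_exp2l ?card_finField_gt1 //.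
by rewrite (exponent_kernel dimK) ?orbT.
Qed.

Lemma card_meeting_image (h : 'End(V)) b k x :
    (b <= k)%N -> (k <= n)%N -> (b <= \dim (limg h))%N ->
    (\dim (limg h) + k <= n + b)%N -> (x <= b * (n + b - (k + \dim (limg h))))%N ->
  (#|subspaces_meeting (limg h) b k| * q ^ x <= n.+1 ^ 2 * q ^ (n ^ 2 %/ 4))%N.
Proof.
move=> le_bk le_kn le_br le_rk le_x.
apply: leq_trans (leq_mul (card_subspaces_meeting _ le_bk le_kn) (leqnn _)) _.
rewrite -mulnA -expnD leq_mul2l leq_exp2l ?card_finField_gt1 //.
by rewrite exponent_image ?orbT.
Qed.

Lemma card_dim_off_center k m x : (k <= n)%N -> (m + 2 * k <= n)%N \/ (m + n <= 2 * k)%N ->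
  (4 * x <= m ^ 2)%N ->
  (#|[set U : {vspace V} | \dim U == k]| * q ^ x <= n.+1 * q ^ (n ^ 2 %/ 4))%N.
Proof.
move=> le_kn off le_x.
apply: leq_trans (leq_mul (card_subspaces_dim_le _ le_kn) (leqnn _)) _.
rewrite -mulnA -expnD leq_mul2l leq_exp2l ?card_finField_gt1 //.
by rewrite (exponent_off_center le_kn off).
Qed.

Lemma mem_meeting_kernel (h : 'End(V)) U :
  U \in subspaces_meeting (lker h) (\dim U - \dim (h @: U))%N (\dim U).
Proof.
rewrite inE eqxx /=; apply/existsP; exists (U :&: lker h)%VS.
by rewrite capvSl capvSr -(limg_ker_dim h U) addnK eqxx.
Qed.

Lemma mem_meeting_image (h : 'End(V)) U : (h @: U <= U)%VS ->
  U \in subspaces_meeting (limg h) (\dim (h @: U)) (\dim U).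
Proof.
move=> shU; rewrite inE eqxx /=; apply/existsP; exists (h @: U)%VS.
by rewrite shU limgS ?subvf /=.
Qed.

Variables (sigma : F -> F) (d : V) (s : 'S_n).
Hypotheses (sigmaD : {morph sigma : x y / x + y}) (sigmaM : {morph sigma : x y / x * y}).
Hypotheses (sigma_inj : injective sigma) (d_neq0 : forall i, d 0 i != 0).
Local Notation g := (monomial_act sigma d s).

Lemma monomial_actD u v : g (u + v) = g u + g v.
Proof.
by apply/rowP=> j; rewrite -[j](permKV s) [RHS]mxE !monomial_actE mxE sigmaD mulrDl.
Qed.

Lemma monomial_actZ c u : g (c *: u) = sigma c *: g u.
Proof.
by apply/rowP=> j; rewrite -[j](permKV s) [RHS]mxE !monomial_actE mxE sigmaM mulrA.
Qed.

Lemma monomial_act_inj : injective g.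
Proof.
move=> u v /rowP eq_g; apply/rowP=> i; have := eq_g (s i).
by rewrite !monomial_actE => /(mulIf (d_neq0 i))/sigma_inj.
Qed.

Definition invariant_dim k := [set U in invariant_subspaces g | \dim U == k].

(** The exponent saved for each coordinate of the defect. *)
Variable sv : nat.
Hypothesis sv_le : (128 * (256 * sv) <= n)%N.

Lemma card_invariant_off_center k x : (k <= n)%N ->
    (n %/ 64 + 2 * k <= n)%N \/ (n %/ 64 + n <= 2 * k)%N -> (x <= n * sv)%N ->
  (#|invariant_dim k| * q ^ x <= n.+1 * q ^ (n ^ 2 %/ 4))%N.
Proof.
move=> le_kn off le_x.
have le_x4 : (4 * x <= (n %/ 64) ^ 2)%N.
  by apply: leq_trans (saving_le_sqr sv_le); rewrite leq_mul2l.
apply: leq_trans (card_dim_off_center le_kn off le_x4); rewrite leq_mul2r.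
by apply/orP; right; apply/subset_leq_card/subsetP=> U; rewrite !inE => /andP[].
Qed.

(** Far from every scalar: either U is generated by a subspace of dimension
    k - m, or g is linear and some g - lam has rank b < 2m on U although its
    rank on F^n exceeds n / 24. *)
Lemma card_invariant_large k : (k <= n)%N ->
    (63 * n <= 128 * k <= 65 * n)%N -> ~ (n %/ 64 + n <= 2 * k)%N ->
    (sigma =1 id -> forall lam, n < 8 * #|defect lam d s|)%N ->
  (#|invariant_dim k| * q ^ (n * sv) <= q.+1 * n.+1 ^ 3 * q ^ (n ^ 2 %/ 4))%N.
Proof.
move=> le_kn /andP[ge_k le_k] not_right large.
pose m := (n %/ 64)%N; have le_m : (64 * m <= n)%N by rewrite /m; lia.
have le_2mk : (2 * m <= k)%N by rewrite /m; lia.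
have not_gen : (m + 2 * (k - m) <= n)%N by rewrite /m; lia.
pose Q := (n ^ 2 %/ 4)%N.
pose gen (X : {vspace V}) := (X + image_span g X)%VS.
(* The two alternatives of [invariant_generated_or_scalar]. *)
pose S1 := [set gen X | X in [set X : {vspace V} | \dim X == k - m]%N].
pose S2 lam := \bigcup_(b < 2 * m) subspaces_meeting (lker (shifted lam d s)) (k - b)%N k.
pose S := S1 :|: (if [forall c, sigma c == c] then \bigcup_lam S2 lam else set0).
have sub : invariant_dim k \subset S.
  apply/subsetP=> U; rewrite inE => /andP[/invariant_subspacesP invU /eqP dU].
  have le_2mU : (2 * m <= \dim U)%N by rewrite dU.
  have [[X dX defU]|[lam [W [dW gW sg1]]]] :=
      invariant_generated_or_scalar monomial_actD monomial_actZ monomial_act_inj invU le_2mU.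
    rewrite inE; apply/orP; left; apply/imsetP.
    by exists X; rewrite // inE dX dU.
  have sg_id : [forall c, sigma c == c] by apply/forallP=> c; apply/eqP/sg1.
  rewrite inE sg_id; apply/orP; right; apply/bigcupP; exists lam => //.
  have lt_b : (\dim (shifted lam d s @: U) < 2 * m)%N.
    apply: leq_ltn_trans dW; apply: dimvS; apply/subvP=> _ /memv_imgP[u Uu ->].
    rewrite shiftedE; have := gW u Uu; rewrite /monomial_act (_ : map_mx sigma u = map_mx id u) //.
    by apply/rowP=> i; rewrite !mxE sg1.
  by apply/bigcupP; exists (Ordinal lt_b) => //=; rewrite -dU mem_meeting_kernel.
have card1 : (#|S1| * q ^ (n * sv) <= n.+1 * q ^ Q)%N.
  apply: leq_trans (card_dim_off_center _ (or_introl not_gen) (saving_le_sqr sv_le)).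
    by rewrite leq_mul2r leq_imset_card orbT.
  exact: leq_trans (leq_subr _ _) le_kn.
have card2 : (#|if [forall c, sigma c == c] then \bigcup_lam S2 lam else set0| * q ^ (n * sv)
    <= q * n.+1 ^ 3 * q ^ Q)%N.
  case: forallP => [sg_id|_]; last by rewrite cards0.
  have {}large := large (fun c => eqP (sg_id c)).
  apply: leq_trans (leq_mul (card_bigcup_le _ _) (leqnn _)) _.
  rewrite big_distrl -mulnA -sum_nat_const /=; apply: leq_sum => lam _.
  apply: leq_trans (leq_mul (card_bigcup_le _ _) (leqnn _)) _.
  rewrite big_distrl /=.
  apply: (@leq_trans (\sum_(b < 2 * m) n.+1 ^ 2 * q ^ Q)); last first.
    rewrite sum_nat_const card_ord [(n.+1 ^ 3)%N]expnS -[X in (_ <= X)%N]mulnA leq_mul2r.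
    by apply/orP; right; rewrite /m; lia.
  apply: leq_sum => b _; have lt_b := ltn_ord b.
  have gt_r : (n < 24 * \dim (limg (shifted lam d s)))%N.
    by have := defect_le_rank lam s d_neq0; have := large lam; lia.
  set r : nat := \dim _ in gt_r.
  have lt_br : (96 * r >= 96 * b + n)%N by lia.
  apply: card_meeting_kernel => //; rewrite -/r; try lia.
  have le1 : (n <= 4 * (k - b))%N by lia.
  have le2 : (n <= 96 * (r - b))%N by lia.
  nia.
apply: leq_trans (leq_mul (subset_leq_card sub) (leqnn _)) _.
apply: leq_trans (leq_mul (leq_card_setU _ _) (leqnn _)) _.
rewrite mulnDl; apply: leq_trans (leq_add card1 card2) _.
rewrite -mulnDl leq_mul2r mulSn leq_add2r; apply/orP; right.
by rewrite -{1}(expn1 n.+1) leq_pexp2l.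
Qed.

(** Close to the scalar lam: depending on whether the rank b of g - lam on U is
    at most half of its rank r on F^n, the kernel or the image of g - lam shows
    that U is rare.  Either way the saving is at least n r / 8. *)
Lemma card_invariant_small k lam : (k <= n)%N -> sigma =1 id ->
    (63 * n <= 128 * k <= 65 * n)%N ->
    (0 < #|defect lam d s|)%N -> (8 * #|defect lam d s| <= n)%N ->
  (#|invariant_dim k| * q ^ (#|defect lam d s| * sv) <= n.+1 ^ 3 * q ^ (n ^ 2 %/ 4))%N.
Proof.
move=> le_kn sg1 /andP[ge_k le_k]; set t := #|_| => t_gt0 le_tn.
have le_rt := rank_shifted_le lam d s; have le_tr := defect_le_rank lam s d_neq0.
move: le_rt le_tr; rewrite -/t; set h := shifted lam d s.
set r : nat := \dim (limg h) => le_rt le_tr.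
pose S b := if (2 * b <= r)%N then subspaces_meeting (lker h) (k - b)%N k
            else subspaces_meeting (limg h) b k.
have sub : invariant_dim k \subset \bigcup_(b < (minn k r).+1) S b.
  apply/subsetP=> U; rewrite inE => /andP[/invariant_subspacesP invU /eqP dU].
  have lt_b : (\dim (h @: U) < (minn k r).+1)%N.
    rewrite ltnS leq_min -{1}dU -(limg_ker_dim h U) leq_addl.
    by rewrite /r dimvS // limgS // subvf.
  apply/bigcupP; exists (Ordinal lt_b) => //=; rewrite /S -dU.
  case: ifP => _; first exact: mem_meeting_kernel.
  apply: mem_meeting_image; apply/subvP=> _ /memv_imgP[u Uu ->].
  rewrite shiftedE memvB ?memvZ //; have := invU u Uu.
  rewrite /monomial_act (_ : map_mx sigma u = map_mx id u) //.
  by apply/rowP=> i; rewrite !mxE sg1.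
apply: leq_trans (leq_mul (subset_leq_card sub) (leqnn _)) _.
apply: leq_trans (leq_mul (card_bigcup_le _ _) (leqnn _)) _.
rewrite big_distrl /=.
apply: (@leq_trans (\sum_(b < (minn k r).+1) n.+1 ^ 2 * q ^ (n ^ 2 %/ 4))); last first.
  rewrite sum_nat_const card_ord [(n.+1 ^ 3)%N]expnS -[X in (_ <= X)%N]mulnA leq_mul2r.
  by apply/orP; right; lia.
apply: leq_sum => b _; have := ltn_ord b; rewrite ltnS leq_min => /andP[le_bk le_br].
have le_kb : (n <= 4 * (k - b))%N by lia.
rewrite /S; case: (leqP (2 * b) r) => le_2b.
  apply: card_meeting_kernel => //; rewrite -/r.
  have le2 : (r <= 2 * (r - b))%N by lia.
  have le3 : (n * r <= 8 * ((k - b) * (r - b)))%N by nia.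
  nia.
apply: card_meeting_image => //; rewrite -/r; first by lia.
have le2 : (n <= 4 * (n + b - (k + r)))%N by lia.
have le3 : (n * r <= 8 * (b * (n + b - (k + r))))%N by nia.
nia.
Qed.

Hypothesis n_gt0 : (0 < n)%N.

(** If g is linear and t(lam) <= n / 8 for some lam, that lam is taken.  In all
    other cases lam = 0 is, whose defect is everything, so that the strongest
    saving is claimed; [card_invariant_large] provides it. *)
Lemma card_invariant_le :
    (sigma =1 id -> forall lam, 0 < #|defect lam d s|)%N ->
  exists lam, (0 < #|defect lam d s|)%N /\
    (#|invariant_subspaces g| * q ^ (#|defect lam d s| * sv)
       <= q.+1 * n.+1 ^ 4 * q ^ (n ^ 2 %/ 4))%N.
Proof.
move=> nonscalar.
suff [lam [t_gt0 le_k]] : exists lam, (0 < #|defect lam d s|)%N /\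
    forall k, (k <= n)%N -> (#|invariant_dim k| * q ^ (#|defect lam d s| * sv)
       <= q.+1 * n.+1 ^ 3 * q ^ (n ^ 2 %/ 4))%N.
  exists lam; split=> //.
  have sub : invariant_subspaces g \subset \bigcup_(k < n.+1) invariant_dim k.
    apply/subsetP=> U invU.
    have lt_dim : (\dim U < n.+1)%N.
      by rewrite ltnS -[X in (_ <= X)%N](dim_rowspace F) dimvS ?subvf.
    by apply/bigcupP; exists (Ordinal lt_dim) => //; rewrite inE invU /=.
  apply: leq_trans (leq_mul (subset_leq_card sub) (leqnn _)) _.
  apply: leq_trans (leq_mul (card_bigcup_le _ _) (leqnn _)) _.
  rewrite big_distrl /=.
  apply: (@leq_trans (\sum_(k < n.+1) q.+1 * n.+1 ^ 3 * q ^ (n ^ 2 %/ 4))).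
    by apply: leq_sum => k _; apply: le_k; rewrite -ltnS.
  rewrite sum_nat_const card_ord (expnS _ 3); apply/eq_leq; ring.
have off k x : (k <= n)%N -> (x <= n * sv)%N -> 
    (n %/ 64 + 2 * k <= n)%N || (n %/ 64 + n <= 2 * k)%N ->
    (#|invariant_dim k| * q ^ x <= q.+1 * n.+1 ^ 3 * q ^ (n ^ 2 %/ 4))%N.
  move=> le_kn le_x /orP off; apply: leq_trans (card_invariant_off_center le_kn off le_x) _.
  rewrite leq_mul2r; apply/orP; right.
  by rewrite -[X in (X <= _)%N]mul1n leq_mul // -{1}(expn1 n.+1) leq_pexp2l.
have t_le lam : (#|defect lam d s| * sv <= n * sv)%N.
  by rewrite leq_mul2r -[X in (_ <= X)%N](card_ord n) max_card orbT.
have [/existsP[lam /andP[sg_id small]]|/existsPn large] := boolP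
    [exists lam, [forall c, sigma c == c] && (8 * #|defect lam d s| <= n)%N].
  have sg1 : sigma =1 id by move=> c; apply/eqP/(forallP sg_id).
  exists lam; split=> [|k le_kn]; first exact: nonscalar.
  have [/off-> //|] := boolP ((n %/ 64 + 2 * k <= n)%N || (n %/ 64 + n <= 2 * k)%N).
  rewrite negb_or => /andP[off1 off2].
  have central := central_dims off1 off2.
  apply: leq_trans (card_invariant_small le_kn sg1 central _ small) _.
    exact: nonscalar.
  by rewrite -mulnA leq_pmull.
exists 0; rewrite defect0 // cardsT card_ord; split=> // k le_kn.
have [/off-> //|] := boolP ((n %/ 64 + 2 * k <= n)%N || (n %/ 64 + n <= 2 * k)%N).
rewrite negb_or => /andP[off1 off2].
apply: card_invariant_large => //; first exact: central_dims.
  by apply/negP.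
move=> sg1 lam; have := large lam; rewrite (_ : [forall c, _]) /= -?ltnNge //.
by apply/forallP=> c; apply/eqP.
Qed.
End InvariantCount.

(** * Summation over the nonscalar maps *)

Lemma bin_le_expn n k : ('C(n, k) <= n ^ k)%N.
Proof.
elim: n k => [|n IHn] [|k]; rewrite ?bin0 ?expn0 ?bin0n //.
rewrite binS; apply: leq_trans (leq_add (IHn k.+1) (IHn k)) _.
rewrite expnS -mulSnr expnS leq_mul2l /=.
by case: k => // k; rewrite leq_exp2r.
Qed.

Section NonscalarSum.
Variables (F : finFieldType) (n : nat).
Local Notation V := 'rV[F]_n.
Local Notation q := #|F|.

(** Outside of its defect T a pair (d, s) is known, so its restriction to T
    determines it. *)
Lemma card_defect_eq lam (T : {set 'I_n}) :
  (#|[set ds : V * 'S_n | defect lam ds.1 ds.2 == T]| <= (q * n) ^ #|T|)%N.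
Proof.
pose f (ds : V * 'S_n) := [ffun i : {i | i \in T} => (ds.1 0 (val i), ds.2 (val i))].
have f_inj : {in [set ds : V * 'S_n | defect lam ds.1 ds.2 == T] &, injective f}.
  move=> [d s] [d' s']; rewrite !inE /= => /eqP dT /eqP dT' /ffunP eq_f.
  have eq_i i : (d 0 i = d' 0 i) * (s i = s' i).
    have [Ti|nTi] := boolP (i \in T).
      by have := eq_f (exist _ i Ti); rewrite !ffunE /= => -[-> ->].
    have := nTi; have := nTi; rewrite -{1}dT -{1}dT' !inE !negbK.
    by move=> /andP[/eqP-> /eqP->] /andP[/eqP-> /eqP->].
  by congr (_, _); [apply/rowP=> i | apply/permP=> i]; rewrite (eq_i i).
rewrite -(card_in_imset f_inj); apply: leq_trans (max_card _) _.
by rewrite card_ffun card_sig card_prod card_ord.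
Qed.

(** After division by q^(n sv) and q^sv this is the sum over nonempty T of
    (q n)^|T| q^(-|T| sv), with at most n^t sets T of size t.  As
    q n^2 <= q^sv, each of the n terms of this sum over t is at most the one for
    t = 1.  Multiplying out keeps everything in nat. *)
Lemma sum_defect_le lam sv : (q * n ^ 2 <= q ^ sv)%N ->
  (\sum_(ds : V * 'S_n | defect lam ds.1 ds.2 != set0)
      q ^ ((n - #|defect lam ds.1 ds.2|) * sv) * q ^ sv
     <= n * (q * n ^ 2) * q ^ (n * sv))%N.
Proof.
move=> le_sv; have q_gt0 := ltnW (card_finField_gt1 F).
rewrite (partition_big (fun ds : V * 'S_n => defect lam ds.1 ds.2) (fun T => T != set0)) //=.
have lt_card (T : {set 'I_n}) : (#|T| < n.+1)%N.
  by rewrite ltnS -[X in (_ <= X)%N](card_ord n) max_card.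
apply: (@leq_trans (\sum_(T : {set 'I_n} | T != set0)
    (q * n) ^ #|T| * (q ^ ((n - #|T|) * sv) * q ^ sv))%N).
  apply: leq_sum => T T_neq0.
  rewrite (eq_bigl (fun ds => ds \in [set ds : V * 'S_n | defect lam ds.1 ds.2 == T])); last first.
    move=> ds; rewrite [RHS]inE; case: (eqVneq (defect lam ds.1 ds.2) T) => [->|].
      by rewrite T_neq0.
    by rewrite andbF.
  rewrite (eq_bigr (fun=> (q ^ ((n - #|T|) * sv) * q ^ sv)%N)); last first.
    by move=> ds; rewrite inE => /eqP->.
  by rewrite sum_nat_const leq_mul2r card_defect_eq orbT.
rewrite (partition_big (fun T : {set 'I_n} => Ordinal (lt_card T))
  (fun t => t != ord0)); last first.
  by move=> T; rewrite -cards_eq0 -val_eqE.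
rewrite big_mkcond big_ord_recl /= add0n.
apply: (@leq_trans (\sum_(i < n) (q * n ^ 2) * q ^ (n * sv))); last first.
  by rewrite sum_nat_const card_ord mulnA.
apply: leq_sum => i _; set t := lift ord0 i.
have t_i : t = i.+1 :> nat by rewrite lift0.
rewrite (eq_bigr (fun=> (q * n) ^ t * (q ^ ((n - t) * sv) * q ^ sv))%N); last first.
  by move=> T /andP[_ /eqP<-].
rewrite sum_nat_const.
apply: (@leq_trans (n ^ t * ((q * n) ^ t * (q ^ ((n - t) * sv) * q ^ sv)))).
  rewrite leq_mul2r; apply/orP; right; apply: leq_trans (bin_le_expn n t).
  rewrite -[X in 'C(X, _)](card_ord n) -card_draws; apply/subset_leq_card/subsetP=> T.
  by rewrite unfold_in inE -val_eqE => /andP[].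
rewrite mulnA -expnMn (_ : n * (q * n) = q * n ^ 2)%N; last by ring.
have le_i : ((q * n ^ 2) ^ i <= (q ^ sv) ^ i)%N.
  by case: (i : nat) => // j; rewrite leq_exp2r.
rewrite t_i expnS; move: (q * n ^ 2)%N le_i => y le_i.
rewrite -mulnA leq_mul2l; apply/orP; right.
apply: leq_trans (leq_mul le_i (leqnn _)) _.
rewrite -expnM -!expnD leq_exp2l ?card_finField_gt1 //; have := ltn_ord i.
nia.
Qed.

Definition scalar_triple (sigma : {perm F}) (d : V) (s : 'S_n) : bool :=
  (sigma == 1%g) && [exists lam, defect lam d s == set0].

(** The scalar lam of [card_invariant_le] depends on the map; summing over all
    lam with nonempty defect avoids having to choose it, at the cost of a
    factor q. *)
Lemma sum_nonscalar_le (A : {set {perm F}}) (D : {set V}) sv :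
    (0 < n)%N -> (128 * (256 * sv) <= n)%N -> (q * n ^ 2 <= q ^ sv)%N ->
    (forall sigma : {perm F}, sigma \in A ->
       {morph sigma : x y / x + y} /\ {morph sigma : x y / x * y}) ->
    (forall d, d \in D -> forall i, d 0 i != 0) ->
  ((\sum_(sigma in A) \sum_(ds : V * 'S_n | (ds.1 \in D) && ~~ scalar_triple sigma ds.1 ds.2)
      #|invariant_subspaces (monomial_act sigma ds.1 ds.2)|) * q ^ sv
   <= #|A| * (q * (q.+1 * n.+1 ^ 4 * (n * (q * n ^ 2)))) * q ^ (n ^ 2 %/ 4))%N.
Proof.
move=> n_gt0 sv_le sv_ge A_morph D_neq0; have q_gt0 := ltnW (card_finField_gt1 F).
set C := (q.+1 * n.+1 ^ 4)%N; set Q := (n ^ 2 %/ 4)%N.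
have term (sigma : {perm F}) ds : sigma \in A ->
    (ds.1 \in D) && ~~ scalar_triple sigma ds.1 ds.2 ->
    (#|invariant_subspaces (monomial_act sigma ds.1 ds.2)| * q ^ sv * q ^ (n * sv) <=
       C * q ^ Q * \sum_(lam | defect lam ds.1 ds.2 != set0)
                      q ^ ((n - #|defect lam ds.1 ds.2|) * sv) * q ^ sv)%N.
  move=> Asigma /andP[Dd ns]; have [sigmaD sigmaM] := A_morph _ Asigma.
  have ns' : sigma =1 id -> forall lam, (0 < #|defect lam ds.1 ds.2|)%N.
    move=> sg1 lam; rewrite card_gt0; apply: contra ns => def0; apply/andP; split.
      by apply/eqP/permP=> c; rewrite perm1 sg1.
    by apply/existsP; exists lam.
  have [lam [t_gt0]] :=
    card_invariant_le sigmaD sigmaM (@perm_inj _ sigma) (D_neq0 _ Dd) sv_le n_gt0 ns'.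
  set t := #|defect _ _ _| in t_gt0 * => le_inv.
  have le_tn : (t <= n)%N by rewrite -[X in (_ <= X)%N](card_ord n) max_card.
  rewrite (bigD1 lam) /=; last by rewrite -cards_eq0 -lt0n.
  rewrite -/t; apply: (@leq_trans (C * q ^ Q * (q ^ ((n - t) * sv) * q ^ sv))); last first.
    by rewrite leq_mul2l leq_addr orbT.
  have -> : (q ^ (n * sv) = q ^ (t * sv) * q ^ ((n - t) * sv))%N.
    by rewrite -expnD -mulnDl subnKC.
  move: #|invariant_subspaces _| le_inv => N le_inv.
  apply: (@leq_trans (N * q ^ (t * sv) * (q ^ ((n - t) * sv) * q ^ sv))).
    move: (q ^ sv)%N (q ^ (t * sv))%N (q ^ ((n - t) * sv))%N => x y z.
    by apply/eq_leq; ring.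
  by rewrite leq_mul2r le_inv orbT.
(* Scaling by q^(n sv) turns the saving q^(-t sv) into the power q^((n - t) sv). *)
have qn_gt0 : (0 < q ^ (n * sv))%N by rewrite expn_gt0 q_gt0.
rewrite -(leq_pmul2r qn_gt0) -mulnA big_distrl /=.
apply: (@leq_trans (\sum_(sigma in A) C * q ^ Q * (q * (n * (q * n ^ 2) * q ^ (n * sv))))).
  apply: leq_sum => sigma Asigma; rewrite big_distrl /=.
  apply: (@leq_trans (C * q ^ Q * \sum_lam \sum_(ds : V * 'S_n | defect lam ds.1 ds.2 != set0)
      q ^ ((n - #|defect lam ds.1 ds.2|) * sv) * q ^ sv)).
    rewrite big_distrr /= .
    under [X in (_ <= X)%N]eq_bigr do rewrite big_distrr /=.
    rewrite (exchange_big_dep xpredT) //= big_mkcond /=; apply: leq_sum => ds _.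
    case: ifP => // cond; rewrite mulnA; apply: leq_trans (term _ _ Asigma cond) _.
    by rewrite big_distrr.
  rewrite leq_mul2l; apply/orP; right.
  rewrite -sum_nat_const; apply: leq_sum => lam _; exact: sum_defect_le.
rewrite sum_nat_const; apply/eq_leq; ring.
Qed.
End NonscalarSum.

(** * Equivalence classes of codes as orbits *)

Section CodesAsSubspaces.
Variables (F : finFieldType) (n : nat).
Local Notation V := 'rV[F]_n.
Implicit Types (U : {vspace V}) (C : {set V}).

Definition codewords U : {set V} := [set u | u \in U].

Lemma codewords_inj : injective codewords.
Proof. by move=> U W /setP eqUW; apply/vspaceP=> u; have := eqUW u; rewrite !inE. Qed.

Lemma linear_codesP C :
  reflect (exists U, C = codewords U) (C \in linear_codes F n).
Proof.
rewrite inE; apply: (iffP (asboolP _)) => [[C0 Clin]|[U ->]]; last first.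
  by split=> [|a u v]; rewrite !inE ?mem0v // => Uu Uv; rewrite memvD ?memvZ.
exists <<enum C>>%VS; apply/setP=> u; rewrite inE.
apply/idP/idP => [Cu|]; first by rewrite memv_span ?mem_enum.
move/(@coord_span _ _ _ (in_tuple (enum C)))->.
elim/big_ind: _ => // [v w Cv Cw|i _]; first by rewrite -[v]scale1r Clin.
rewrite -[_ *: _]addr0 Clin // -mem_enum.
by apply: mem_nth; apply: ltn_ord.
Qed.

Lemma card_linear_codes_fixed (f : {perm V}) :
  #|[set C in linear_codes F n | f @: C == C]| = #|invariant_subspaces f|.
Proof.
rewrite -(card_imset _ codewords_inj); apply: eq_card => C; rewrite inE.
apply/andP/imsetP => [[/linear_codesP[U ->] /eqP fU]|[U /invariant_subspacesP invU ->]].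
  exists U => //; apply/invariant_subspacesP=> u Uu.
  by move/setP/(_ (f u)): fU; rewrite inE => <-; rewrite imset_f ?inE.
split; first by apply/linear_codesP; exists U.
rewrite eqEcard card_imset ?leqnn ?andbT; last exact: perm_inj.
apply/subsetP=> _ /imsetP[u Uu ->]; move: Uu; rewrite !inE.
exact: invU.
Qed.

(** The Cauchy-Frobenius formula for the action of G on the codes, where a code
    fixed by f is an f-invariant subspace. *)
Lemma num_classes_orbits (G : {group {perm V}}) (e : rel {set V}) :
    (forall C D, C \in linear_codes F n -> e C D = [exists f in G, D == f @: C]) ->
    (forall f C, f \in G -> C \in linear_codes F n -> f @: C \in linear_codes F n) ->
  (num_classes e * #|G| = \sum_(f in G) #|invariant_subspaces f|)%N.
Proof.
move=> eE G_codes; pose to := ('P^* : {action {perm V} &-> {set V}})%act.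
have toE C f : to C f = f @: C by rewrite /= setactE.
have Gacts : [acts G, on linear_codes F n | to].
  apply/actsP=> f Gf C; rewrite toE; apply/idP/idP => [|CC]; last exact: G_codes.
  move=> fC; have := G_codes _ _ (groupVr Gf) fC.
  rewrite -imset_comp (eq_imset (g := id)) ?imset_id // => u /=.
  by rewrite permK.
have -> : num_classes e = #|orbit to G @: linear_codes F n|.
  congr #|pred_of_set _|; apply: eq_in_imset => C CC; apply/setP=> D.
  rewrite inE eE //; apply/andP/orbitP => [[_ /exists_inP[f Gf /eqP->]]|[f Gf <-]].
    by exists f.
  rewrite toE G_codes //; split=> //; apply/exists_inP; exists f => //.
have -> := esym (Frobenius_Cauchy Gacts).
apply: eq_bigr => f _; rewrite -card_linear_codes_fixed.
apply: eq_card => C; rewrite in_setI [RHS]inE; congr (_ && _).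
by apply/afix1P/eqP; rewrite toE.
Qed.
End CodesAsSubspaces.

Section MonomialGroup.
Variables (F : finFieldType) (n : nat).
Local Notation V := 'rV[F]_n.
Local Notation q := #|F|.

Variables (A : {group {perm F}}) (S : {set F}).
Hypotheses (n_gt0 : (0 < n)%N)
  (A_morph : forall sigma : {perm F}, sigma \in A ->
     {morph sigma : x y / x + y} /\ {morph sigma : x y / x * y})
  (S1 : 1 \in S) (S0 : 0 \notin S) (SM : {in S &, forall x y, x * y \in S})
  (S_stable : forall (sigma : {perm F}) x, sigma \in A -> x \in S -> sigma x \in S).

Definition scalings : {set V} := [set d : V | [forall i, d 0 i \in S]].

Lemma scalingsP (d : V) : reflect (forall i, d 0 i \in S) (d \in scalings).
Proof. by rewrite inE; apply: forallP. Qed.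

Lemma card_scalings : #|scalings| = (#|S| ^ n)%N.
Proof.
pose f (g : {ffun 'I_n -> F}) : V := \row_i g i.
have f_inj : injective f.
  by move=> g h /rowP eq_f; apply/ffunP=> i; have := eq_f i; rewrite !mxE.
rewrite -[n in RHS]card_ord -card_ffun_on -(card_imset _ f_inj); apply: eq_card => d.
apply/scalingsP/imsetP => [Sd|[g /ffun_onP Sg ->] i]; last by rewrite mxE.
exists [ffun i => d 0 i]; first by apply/ffun_onP=> i; rewrite ffunE.
by apply/rowP=> i; rewrite mxE ffunE.
Qed.

Lemma scalings_neq0 (d : V) : d \in scalings -> forall i, d 0 i != 0.
Proof. by move=> /scalingsP Sd i; apply: contraNneq S0 => <-. Qed.

Local Notation triple := ({perm F} * (V * 'S_n))%type.

Definition triples : {set triple} := setX A (setX scalings setT).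

(** The default 1 is never reached: [monomial_permE] applies on all of
    [triples]. *)
Definition monomial_perm (t : triple) : {perm V} :=
  odflt 1%g [pick f : {perm V} | [forall u, f u == monomial_act t.1 t.2.1 t.2.2 u]].

Lemma monomial_permE t u : t \in triples ->
  monomial_perm t u = monomial_act t.1 t.2.1 t.2.2 u.
Proof.
case: t => sigma [d s]; rewrite !in_setX /= => /and3P[Asigma /scalings_neq0 nz_d _].
have inj : injective (monomial_act sigma d s).
  by apply: monomial_act_inj nz_d; apply: perm_inj.
rewrite /monomial_perm; case: pickP => [f /forallP/(_ u)/eqP //|/(_ (perm inj))/=].
by move/negbT/forallPn=> [v]; rewrite permE eqxx.
Qed.

Lemma aut_fix01 (sigma : {perm F}) : sigma \in A -> sigma 0 = 0 /\ sigma 1 = 1.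
Proof.
move=> /A_morph[sD sM]; have s0 : sigma 0 = 0.
  by apply: (addrI (sigma 0)); rewrite -sD !addr0.
split=> //; have : sigma 1 != 0.
  by rewrite -s0 (inj_eq perm_inj) oner_neq0.
by move/mulfI; apply; rewrite -sM !mulr1.
Qed.

(** The images of the unit vectors reveal s and d, those of constant vectors then
    reveal sigma.  For the zero space this would fail. *)
Lemma monomial_perm_inj : {in triples &, injective monomial_perm}.
Proof.
move=> [sigma [d s]] [sigma' [d' s']] tt tt' /permP eq_p.
have eq_act u : monomial_act sigma d s u = monomial_act sigma' d' s' u.
  by have := eq_p u; rewrite !monomial_permE.
move: tt tt'; rewrite !in_setX /= => /and3P[As Sd _] /and3P[As' Sd' _].
have nz := scalings_neq0 Sd; have nz' := scalings_neq0 Sd'.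
have [s0 s1] := aut_fix01 As; have [s0' s1'] := aut_fix01 As'.
have eq_s : s = s'.
  apply/permP=> i; apply/eqP; apply: contraT => ne.
  have /rowP/(_ (s i)) := eq_act (delta_mx 0 i).
  rewrite monomial_actE -[s i](permKV s') monomial_actE !mxE !eqxx s1 mul1r.
  rewrite (negbTE (_ : (s'^-1)%g (s i) != i)) ?andbF ?s0' ?mul0r => [/eqP|].
    by rewrite (negbTE (nz i)).
  by apply: contraNneq ne => eq_i; rewrite -{2}eq_i permKV.
rewrite -eq_s in eq_act *.
have eq_d : d = d'.
  apply/rowP=> i; have /rowP/(_ (s i)) := eq_act (delta_mx 0 i).
  by rewrite !monomial_actE !mxE !eqxx s1 s1' !mul1r.
rewrite -eq_d in eq_act *; congr (_, _); apply/permP=> c.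
have /rowP/(_ (s (Ordinal n_gt0))) := eq_act (const_mx c).
by rewrite !monomial_actE !mxE => /(mulIf (nz _)).
Qed.

Lemma monomial_group_set : group_set (monomial_perm @: triples).
Proof.
have const1 : const_mx 1 \in scalings by apply/scalingsP=> i; rewrite mxE.
apply/group_setP; split.
  apply/imsetP; exists (1%g, (const_mx 1, 1%g)).
    by rewrite !in_setX group1 const1 in_setT.
  apply/permP=> u; rewrite monomial_permE ?in_setX ?group1 ?const1 ?in_setT //= perm1.
  apply/rowP=> i; have := monomial_actE (1%g : {perm F}) (const_mx 1) 1%g u i.
  by rewrite !perm1 [const_mx _ _ _]mxE mulr1.
move=> _ _ /imsetP[[sigma [d s]] tt ->] /imsetP[[sigma' [d' s']] tt' ->].
pose t : triple := ((sigma * sigma')%g, (\row_i (sigma' (d 0 i) * d' 0 (s i)), (s * s')%g)).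
have t_in : t \in triples.
  move: tt tt'; rewrite !in_setX /= => /and3P[As /scalingsP Sd _] /and3P[As' /scalingsP Sd' _].
  rewrite groupM // in_setT andbT /=; apply/scalingsP=> i.
  by rewrite mxE SM // S_stable.
apply/imsetP; exists t => //; apply/permP=> u.
rewrite permM !monomial_permE //; apply/rowP=> j.
rewrite -[j](permKV (s * s')%g); move: (_ j) => i.
rewrite monomial_actE {1}permM !monomial_actE /= mxE permM.
move: tt'; rewrite in_setX /= => /andP[/A_morph[_ ->] _].
by rewrite mulrA.
Qed.

Definition monomial_group := Group monomial_group_set.

Lemma card_monomial_group : #|monomial_group| = (#|A| * (#|S| ^ n * n`!))%N.
Proof.
rewrite /= card_in_imset; last exact: monomial_perm_inj.
by rewrite !cardsX card_scalings cardsT card_Sn.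
Qed.

Lemma num_classes_monomial (e : rel {set V}) :
    (forall C D, e C D = [exists t in triples,
       D == [set monomial_act t.1 t.2.1 t.2.2 u | u in C]]) ->
  (num_classes e * (#|A| * (#|S| ^ n * n`!)) =
     \sum_(sigma in A) \sum_(ds : V * 'S_n | ds.1 \in scalings)
        #|invariant_subspaces (monomial_act sigma ds.1 ds.2)|)%N.
Proof.
move=> eE; rewrite -card_monomial_group num_classes_orbits; first last.
- move=> _ C /imsetP[t tt ->] /linear_codesP[U ->]; apply/linear_codesP.
  have [As Sd] : t.1 \in A /\ t.2.1 \in scalings.
    by move: tt; case: t => sigma [d s]; rewrite !in_setX => /and3P[].
  have [sD sM] := A_morph As.
  exists (image_span (monomial_act t.1 t.2.1 t.2.2) U); apply/eqP.
  rewrite eqEcard; apply/andP; split.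
    apply/subsetP=> _ /imsetP[u Uu ->]; rewrite inE in Uu; rewrite inE monomial_permE //.
    by apply: mem_image_span Uu; [apply: monomial_actD | apply: monomial_actZ].
  rewrite card_imset; last exact: perm_inj.
  rewrite !cardsE !card_vspace leq_exp2l ?card_finField_gt1 //.
  exact: dim_image_span.
- move=> C D _; rewrite eE; apply/exists_inP/exists_inP => [[t tt /eqP->]|].
    exists (monomial_perm t); first exact: imset_f.
    by apply/eqP/eq_imset => u; rewrite monomial_permE.
  case=> _ /imsetP[t tt ->] /eqP->; exists t => //.
  by apply/eqP/eq_imset => u; rewrite monomial_permE.
rewrite big_imset /=; last exact: monomial_perm_inj.
rewrite pair_big_dep /=; apply: eq_big => [t|t tt].
  by case: t => sigma [d s]; rewrite !in_setX in_setT andbT.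
by apply: eq_card => U; rewrite !inE; apply: eq_forallb => u; rewrite monomial_permE.
Qed.
End MonomialGroup.

(** * The automorphisms of a finite field *)

Lemma leq_card_rel (T1 T2 : finType) (A1 : {set T1}) (A2 : {set T2})
    (r : T1 -> T2 -> Prop) :
    (forall a, a \in A1 -> exists2 b, b \in A2 & r a b) ->
    (forall a a' b, r a b -> r a' b -> a = a') ->
  (#|A1| <= #|A2|)%N.
Proof.
move=> total inj; have [f fP] : exists f : T1 -> option T2,
    forall a, a \in A1 -> exists b, [/\ f a = Some b, b \in A2 & r a b].
  exists (fun a => [pick b in A2 | `[< r a b >]]) => a /total[b Bb rab].
  case: pickP => [b' /andP[Bb' /asboolP rab']|/(_ b)]; first by exists b'.
  by rewrite Bb /= asboolT.
have f_inj : {in A1 &, injective f}.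
  move=> a a' /fP[b [-> _ rab]] /fP[b' [-> _ rab']] [eq_b].
  by rewrite eq_b in rab; apply: inj rab rab'.
have some_inj : injective (@Some T2) by move=> b b' [].
rewrite -(card_in_imset f_inj) -(card_imset A2 some_inj).
apply/subset_leq_card/subsetP=> _ /imsetP[a Aa ->].
by have [b [-> Bb _]] := fP a Aa; apply: imset_f.
Qed.

Section FieldAutomorphisms.
Variables (F : finFieldType) (p : nat) (charFp : p \in [pchar F]).
Local Notation L := (pPrimeCharType charFp).

Lemma gal_field_aut (x : gal_of {:L}) :
  exists2 s : {perm F}, s \in field_auts F & forall c : F, s c = x (c : L).
Proof.
have x_inj : injective (fun c : F => (x (c : L) : F)) by exact: (lker0P (AEnd_lker0 (gal_repr x))).
exists (perm x_inj) => [|c]; last by rewrite permE.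
rewrite inE; apply/asboolP; split; split.
- by rewrite permE; apply: (rmorph0 x).
- by move=> c c'; rewrite !permE; apply: (rmorphD x).
- by rewrite permE; apply: (rmorph1 x).
- by move=> c c'; rewrite !permE; apply: (rmorphM x).
Qed.

Lemma field_aut_gal (s : {perm F}) : s \in field_auts F ->
  exists2 x : gal_of {:L}, x \in 'Gal({:L} / 1)%g & forall c : F, s c = x (c : L).
Proof.
rewrite inE => /asboolP[[s0 sD] [s1 sM]].
have sN c : s (- c) = - s c.
  by apply: (addrI (s c)); rewrite -sD !subrr s0.
pose f : L -> L := s.
have fA : zmod_morphism f by move=> c c'; rewrite /f sD sN.
have fM : monoid_morphism f by split.
have fZ : scalable f.
  move=> a c; rewrite /f; change (s ((val a)%:R * (c : F)) = (val a)%:R * s c).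
  rewrite sM; congr (_ * _); elim: (val a) => [|k IHk]; first exact: s0.
  by rewrite !mulrS sD s1 IHk.
pose faM := GRing.isZmodMorphism.Build _ _ f fA.
pose fmM := GRing.isMonoidMorphism.Build _ _ f fM.
pose flM := GRing.isScalable.Build _ _ _ _ f fZ.
pose fLRM : {lrmorphism _ -> _} := HB.pack f faM fmM flM.
have /kAut_to_gal[x galx Dx] : kAut 1 {:L} (linfun fLRM).
  rewrite kAutfE; apply/kHomP_tmp; split=> [_ /vlineP[a ->] | u v _ _]; rewrite !lfunE //=.
  by rewrite fZ fM.
by exists x => // c; rewrite -Dx ?memvf // lfunE.
Qed.

(** F is Galois over its prime field, so the order of the Galois group, which
    consists of all field automorphisms, is the degree of F. *)
Lemma card_field_auts : #|F| = (p ^ #|field_auts F|)%N.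
Proof.
have cardF : #|F| = (p ^ \dim {:L})%N.
  by rewrite (pprimeChar_dimf charFp) -(card_pprimeChar charFp).
rewrite cardF; congr (_ ^ _)%N.
have := galois_dim (finField_galois (sub1v {:L})); rewrite dimv1 divn1 => ->.
pose r (s : {perm F}) (x : gal_of {:L}) := forall c : F, s c = x (c : L).
apply/eqP; rewrite eqn_leq; apply/andP; split.
  apply: (leq_card_rel (r := fun x s => r s x)) => [x _|x y s rsx rsy].
    exact: gal_field_aut.
  by apply/eqP/gal_eqP => c _; rewrite -[RHS]rsy; apply/esym/rsx.
apply: (leq_card_rel (r := r)) => [s As|s t x rsx rtx].
  exact: field_aut_gal.
by apply/permP=> c; rewrite rsx rtx.
Qed.
End FieldAutomorphisms.

(** * Bounds on the number of classes *)

Section ClassCountBounds.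
Variables (F : finFieldType).
Local Notation q := #|F|.

Variables (A : {group {perm F}}) (S : {set F}).
Hypotheses
  (A_morph : forall sigma : {perm F}, sigma \in A ->
     {morph sigma : x y / x + y} /\ {morph sigma : x y / x * y})
  (S1 : 1 \in S) (S0 : 0 \notin S) (SM : {in S &, forall x y, x * y \in S})
  (S_stable : forall (sigma : {perm F}) x, sigma \in A -> x \in S -> sigma x \in S).

Lemma scalar_tripleP n (sigma : {perm F}) (d : 'rV[F]_n) (s : 'S_n) :
  reflect (exists lam, [/\ sigma = 1%g, d = const_mx lam & s = 1%g])
          (scalar_triple sigma d s).
Proof.
apply: (iffP andP) => [[/eqP-> /existsP[lam /eqP def0]]|[lam [-> -> ->]]].
  have fix_i i : (s i == i) && (d 0 i == lam).
    by apply: contraFT (in_set0 i) => nfix; rewrite -def0 inE.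
  exists lam; split=> //.
    by apply/rowP=> i; have /andP[_ /eqP->] := fix_i i; rewrite mxE.
  by apply/permP=> i; have /andP[/eqP-> _] := fix_i i; rewrite perm1.
split=> //; apply/existsP; exists lam; apply/eqP/setP=> i.
by rewrite !inE perm1 mxE !eqxx.
Qed.

Lemma sum_scalar_invariants n : (0 < n)%N ->
  (\sum_(sigma in A) \sum_(ds : 'rV[F]_n * 'S_n |
        (ds.1 \in scalings n S) && scalar_triple sigma ds.1 ds.2)
     #|invariant_subspaces (monomial_act sigma ds.1 ds.2)|
   = #|S| * des_inv_sum q n)%N.
Proof.
move=> n_gt0; rewrite (bigD1 1%g) //= [X in (_ + X)%N]big1 ?addn0; last first.
  move=> sigma /andP[_ ne1]; rewrite big_pred0 // => ds.
  by rewrite /scalar_triple (negbTE ne1) andbF.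
pose f (c : F) : 'rV[F]_n * 'S_n := (const_mx c, 1%g).
have f_inj : injective f.
  by move=> c c' [/matrixP/(_ 0 (Ordinal n_gt0))]; rewrite !mxE.
transitivity (\sum_(ds in f @: S) des_inv_sum q n)%N; last first.
  by rewrite sum_nat_const card_imset.
apply: eq_big => [ds|ds /andP[_ /scalar_tripleP[lam [_ -> ->]]]].
  apply/andP/imsetP => [[/scalingsP Sd /scalar_tripleP[lam [_ def_d def_s]]]|[c Sc ->]].
    exists lam; last by rewrite /f -def_d -def_s; case: (ds).
    by have := Sd (Ordinal n_gt0); rewrite def_d mxE.
  split; first by apply/scalingsP=> i; rewrite mxE.
  by apply/scalar_tripleP; exists c.
rewrite -card_subspaces -cardsT; apply: eq_card => U; rewrite in_setT.
apply/invariant_subspacesP=> u Uu.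
suff -> : monomial_act (1%g : {perm F}) (const_mx lam) 1%g u = lam *: u by rewrite memvZ.
apply/rowP=> i; have := monomial_actE (1%g : {perm F}) (const_mx lam) 1%g u i.
by rewrite !perm1 [const_mx _ _ _]mxE => ->; rewrite mxE mulrC.
Qed.

(** The scalar maps account for the main term, [sum_nonscalar_le] for the error;
    there q^(n^2/4) is bounded by the number of subspaces. *)
Lemma num_classes_bounds n sv (e : rel {set 'rV[F]_n}) :
    (0 < n)%N -> (128 * (256 * sv) <= n)%N -> (q * n ^ 2 <= q ^ sv)%N ->
    (forall C D, e C D = [exists t in triples n A S,
       D == [set monomial_act t.1 t.2.1 t.2.2 u | u in C]]) ->
  (#|S| * des_inv_sum q n <= num_classes e * (#|A| * (#|S| ^ n * n`!)))%N /\
  (num_classes e * (#|A| * (#|S| ^ n * n`!)) * q ^ sv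
     <= #|S| * des_inv_sum q n * q ^ sv
        + #|A| * (q * (q.+1 * n.+1 ^ 4 * (n * (q * n ^ 2)))) * des_inv_sum q n)%N.
Proof.
move=> n_gt0 sv_le sv_ge eE; rewrite (num_classes_monomial n_gt0) //.
under eq_bigr => sigma _ do
  rewrite (bigID (fun ds : 'rV[F]_n * 'S_n => scalar_triple sigma ds.1 ds.2)) /=.
rewrite big_split /= sum_scalar_invariants //; split; first exact: leq_addr.
rewrite mulnDl leq_add2l.
have := sum_nonscalar_le n_gt0 sv_le sv_ge A_morph (@scalings_neq0 F n S S0).
move/leq_trans; apply; rewrite leq_mul2l -card_subspaces.
by apply/orP; right; apply: card_subspaces_ge.
Qed.

(** With u = n / (10 c) and c = 128 * 256, the right-hand side is at least
    (2^u)^10 >= (u + 1)^10, while n + 1 <= 10 c (u + 1). *)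
Lemma expn_dominates K : exists n0, forall n, (n0 <= n)%N ->
  (K * n.+1 ^ 9 <= q ^ (n %/ (128 * 256)))%N.
Proof.
(* From here on, only c > 0 matters. *)
move: (128 * 256)%N (isT : 0 < 128 * 256)%N => c c_gt0.
exists (c * (10 * ((c * 10) ^ 9 * K)))%N => n le_n0.
pose u := (n %/ c %/ 10)%N.
have le_u : ((c * 10) ^ 9 * K <= u)%N.
  by rewrite /u -divnMA leq_divRL ?muln_gt0 ?c_gt0 // mulnC -mulnA.
have n_lt : (n.+1 <= (c * 10) * u.+1)%N.
  by rewrite mulnC /u -divnMA ltn_ceil ?muln_gt0 ?c_gt0.
have le_sv : (10 * u <= n %/ c)%N by rewrite mulnC leq_trunc_div.
apply: (@leq_trans (u.+1 ^ 10)%N).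
  apply: (@leq_trans (K * ((c * 10) * u.+1) ^ 9)); first by rewrite leq_mul2l leq_exp2r ?n_lt ?orbT.
  rewrite expnMn mulnA [in X in (_ <= X)%N]expnS leq_mul2r; apply/orP; right.
  by rewrite mulnC (leq_trans le_u).
apply: (@leq_trans (q ^ (u * 10))).
  by rewrite expnM leq_exp2r // ltn_expl // card_finField_gt1.
by rewrite leq_exp2l ?card_finField_gt1 // mulnC.
Qed.

(** The error term divided by the main term is at most poly(n) q^(-cn), which is
    eventually less than 1 / (n + 1). *)
Lemma num_classes_asymptotic (e : forall n, rel {set 'rV[F]_n}) :
    (forall n C D, e n C D = [exists t in triples n A S,
       D == [set monomial_act t.1 t.2.1 t.2.2 u | u in C]]) ->
  exists n0, forall n, (n0 <= n)%N ->
    (#|S| * des_inv_sum q n <= num_classes (e n) * (#|A| * (#|S| ^ n * n`!)))%N /\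
    (num_classes (e n) * (#|A| * (#|S| ^ n * n`!)) * n.+1
       <= #|S| * des_inv_sum q n * n.+2)%N.
Proof.
move=> eE; pose K := (#|A| * (q * (q.+1 * q)) + q)%N.
have [n0 n0P] := expn_dominates K; exists n0.+1 => n lt_n.
have n_gt0 : (0 < n)%N by apply: leq_ltn_trans lt_n.
have [sv sv_le sv_K] : exists2 sv, (128 * (256 * sv) <= n)%N & (K * n.+1 ^ 9 <= q ^ sv)%N.
  exists (n %/ (128 * 256))%N; last exact: n0P (ltnW lt_n).
  by rewrite mulnA mulnC leq_trunc_div.
have q_gt0 : (0 < q)%N := ltnW (card_finField_gt1 F).
have sv_ge : (q * n ^ 2 <= q ^ sv)%N.
  apply: leq_trans sv_K; apply: leq_mul; first exact: leq_addl.
  apply: (@leq_trans (n.+1 ^ 2)); first by rewrite leq_exp2r.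
  by rewrite leq_pexp2l.
have [lower upper] := num_classes_bounds n_gt0 sv_le sv_ge (eE n).
split=> //; set M := (num_classes _ * _)%N in lower upper *.
set G := des_inv_sum q n in lower upper *.
have poly : (#|A| * (q * (q.+1 * n.+1 ^ 4 * (n * (q * n ^ 2)))) * n.+1 <= q ^ sv)%N.
  apply: leq_trans sv_K.
  apply: (@leq_trans (#|A| * (q * (q.+1 * q)) * n.+1 ^ 8)).
    have -> : (#|A| * (q * (q.+1 * n.+1 ^ 4 * (n * (q * n ^ 2)))) * n.+1 =
      #|A| * (q * (q.+1 * q)) * (n.+1 ^ 5 * n ^ 3))%N by ring.
    rewrite leq_mul2l (_ : 8 = 5 + 3)%N // expnD leq_mul2l leq_exp2r //.
    by rewrite leqnSn !orbT.
  by apply: leq_mul; rewrite ?leq_addr // leq_pexp2l.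
have S_gt0 : (0 < #|S|)%N by rewrite card_gt0; apply/set0Pn; exists 1.
have qsv_gt0 : (0 < q ^ sv)%N by rewrite expn_gt0 q_gt0.
rewrite -(leq_pmul2r qsv_gt0) mulnAC.
apply: leq_trans (leq_mul upper (leqnn n.+1)) _; rewrite mulnDl.
have -> : (#|S| * G * n.+2 * q ^ sv = #|S| * G * q ^ sv * n.+1 + #|S| * G * q ^ sv)%N by ring.
rewrite leq_add2l mulnAC (mulnAC #|S|).
apply: (@leq_trans (q ^ sv * G)); first by rewrite leq_mul2r poly orbT.
by rewrite leq_mul2r leq_pmull ?orbT.
Qed.
End ClassCountBounds.

Section Instances.
Variables (F : finFieldType).
Local Notation q := #|F|.

Lemma perm1_morph (sigma : {perm F}) : sigma \in (1%G : {group {perm F}}) ->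
  {morph sigma : x y / x + y} /\ {morph sigma : x y / x * y}.
Proof. by rewrite inE => /eqP->; split=> x y; rewrite !perm1. Qed.

Lemma field_auts_group_set : group_set (field_auts F).
Proof.
apply/group_setP; split=> [|s t].
  by rewrite inE; apply/asboolP; split; split=> [|x y]; rewrite !perm1.
rewrite !inE => /asboolP[[s0 sD] [s1 sM]] /asboolP[[t0 tD] [t1 tM]].
by apply/asboolP; split; split=> [|x y]; rewrite !permM ?s0 ?sD ?s1 ?sM.
Qed.

Canonical field_auts_group := Group field_auts_group_set.

Lemma field_auts_morph (sigma : {perm F}) : sigma \in field_auts_group ->
  {morph sigma : x y / x + y} /\ {morph sigma : x y / x * y}.
Proof. by rewrite inE => /asboolP[[_ sD] [_ sM]]. Qed.

Lemma card_nonzero : #|[set~ (0 : F)]| = q.-1.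
Proof. by rewrite cardsC1. Qed.

Lemma nonzero_mul : {in [set~ 0] &, forall x y : F, x * y \in [set~ 0]}.
Proof. by move=> x y; rewrite !inE => x0 y0; rewrite mulf_neq0. Qed.

Lemma nonzero_stable (A : {group {perm F}}) :
    (forall sigma : {perm F}, sigma \in A ->
       {morph sigma : x y / x + y} /\ {morph sigma : x y / x * y}) ->
  forall (sigma : {perm F}) x, sigma \in A -> x \in [set~ 0] -> sigma x \in [set~ 0].
Proof.
move=> A_morph sigma x /A_morph[sD _]; rewrite !inE; apply: contraNneq => sx0.
have s0 : sigma 0 = 0 by apply: (addrI (sigma 0)); rewrite -sD !addr0.
by apply/eqP/(@perm_inj _ sigma); rewrite sx0 s0.
Qed.

(** The inverse is needed as [col_perm s] moves the entry at s i to i. *)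
Lemma perm_equivE n (C D : {set 'rV[F]_n}) :
  perm_equiv C D = [exists t in triples n 1%G [set 1],
     D == [set monomial_act t.1 t.2.1 t.2.2 u | u in C]].
Proof.
have actE (s : 'S_n) u : monomial_act (1%g : {perm F}) (const_mx 1) s u = col_perm s^-1 u.
  rewrite /monomial_act diag_const_mx mul1mx col_permE invgK.
  by congr (_ *m _); apply/rowP=> i; rewrite mxE perm1.
apply/existsP/exists_inP => [[s /eqP->]|[[sigma [d s]]]].
  exists (1%g, (const_mx 1, s^-1%g)).
    by rewrite !in_setX in_setT andbT /= set11; apply/scalingsP=> i; rewrite mxE set11.
  by apply/eqP/eq_imset=> u; rewrite actE invgK.
rewrite !in_setX in_setT andbT /= => /andP[/set1P-> /scalingsP Sd] /eqP->.
exists s^-1%g; apply/eqP/eq_imset=> u; rewrite -actE; congr monomial_act.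
by apply/rowP=> i; have /set1P-> := Sd i; rewrite mxE.
Qed.

Lemma semilinear_equiv_generic n (A : {group {perm F}}) (C D : {set 'rV[F]_n}) :
  [exists s in A, exists M : 'M[F]_n,
     monomial_mx M && (D == [set map_mx s u *m M | u in C])] =
  [exists t in triples n A [set~ 0],
     D == [set monomial_act t.1 t.2.1 t.2.2 u | u in C]].
Proof.
apply/exists_inP/exists_inP => [[sigma As /existsP[M]]|[[sigma [d s]]]].
  case/andP=> /existsP[s /existsP[d /andP[/forallP nz_d /eqP->]]] /eqP->.
  exists (sigma, (d, s)) => //.
  by rewrite !in_setX in_setT As andbT /=; apply/scalingsP=> i; rewrite !inE.
rewrite !in_setX in_setT andbT /= => /andP[As /scalingsP Sd] /eqP->.
exists sigma => //; apply/existsP; exists (diag_mx d *m perm_mx s); rewrite eqxx andbT.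
apply/existsP; exists s; apply/existsP; exists d; rewrite eqxx andbT.
by apply/forallP=> i; have := Sd i; rewrite !inE.
Qed.

Lemma monomial_equivE n (C D : {set 'rV[F]_n}) :
  monomial_equiv C D = [exists t in triples n 1%G [set~ 0],
     D == [set monomial_act t.1 t.2.1 t.2.2 u | u in C]].
Proof.
have map1 (u : 'rV[F]_n) : map_mx (1%g : {perm F}) u = u.
  by apply/rowP=> i; rewrite mxE perm1.
rewrite -semilinear_equiv_generic; apply/existsP/exists_inP => [[M MP]|[s /set1P->]].
  exists 1%g; first exact: set11.
  apply/existsP; exists M; move: MP; congr (_ && (_ == _)).
  by apply: eq_imset => u; rewrite map1.
move=> /existsP[M MP]; exists M; move: MP; congr (_ && (_ == _)).
by apply: eq_imset => u; rewrite map1.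
Qed.

Lemma semilinear_equivE n (C D : {set 'rV[F]_n}) :
  semilinear_equiv C D = [exists t in triples n field_auts_group [set~ 0],
     D == [set monomial_act t.1 t.2.1 t.2.2 u | u in C]].
Proof. exact: semilinear_equiv_generic. Qed.
End Instances.

(** * The limits *)

Lemma asymp_equiv_of_bounds (R : realType) (s a : nat) (G N : nat -> nat) :
    (0 < s)%N -> (0 < a)%N -> (forall n, 0 < G n)%N ->
    (exists n0, forall n, (n0 <= n)%N ->
      (s * G n <= N n * (a * (s ^ n * n`!)))%N /\
      (N n * (a * (s ^ n * n`!)) * n.+1 <= s * G n * n.+2)%N) ->
  asymp_equiv (fun n => (N n)%:R : R)
    (fun n => (G n)%:R / ((n`!)%:R * s%:R ^+ n.-1 * a%:R)).
Proof.
move=> s_gt0 a_gt0 G_gt0 [n0 bounds]; rewrite /asymp_equiv.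
pose ratio n : R := (N n)%:R / ((G n)%:R / ((n`!)%:R * s%:R ^+ n.-1 * a%:R)).
have squeeze n : (n0 < n)%N -> 1 <= ratio n <= 1 + n.+1%:R^-1.
  move=> lt_n; have [lower upper] := bounds n (ltnW lt_n).
  have n_gt0 : (0 < n)%N by apply: leq_ltn_trans lt_n.
  pose D := (n`! * s ^ n.-1 * a)%N.
  have def_D : (N n * (a * (s ^ n * n`!)) = s * (N n * D))%N.
    have -> : (s ^ n = s * s ^ n.-1)%N by rewrite -expnS prednK.
    by rewrite /D; ring.
  move: lower upper; rewrite def_D -(mulnA s (N n * D)) -(mulnA s (G n)) !leq_pmul2l //.
  move=> lower upper.
  have Gn_gt0 : 0 < (G n)%:R :> R by rewrite ltr0n.
  have -> : ratio n = (N n * D)%:R / (G n)%:R.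
    rewrite /ratio (_ : (n`!)%:R * _ * _ = D%:R); last by rewrite !natrM natrX.
    by rewrite invfM invrK natrM [_^-1 * _]mulrC mulrA.
  apply/andP; split; first by rewrite ler_pdivlMr // mul1r ler_nat.
  rewrite ler_pdivrMr // -(@ler_pM2r _ n.+1%:R) ?ltr0n //.
  have -> : (1 + n.+1%:R^-1) * (G n)%:R * n.+1%:R = (G n * n.+2)%:R :> R.
    by rewrite mulrAC mulrDl mul1r mulVf ?pnatr_eq0 // natr1 natrM mulrC.
  by rewrite -natrM ler_nat.
apply: (@squeeze_cvgr _ _ _ _ (fun=> 1) (fun n => 1 + n.+1%:R^-1)).
- by exists n0.+1 => // n /= /squeeze.
- exact: cvg_cst.
rewrite -[X in (_ --> X)%classic]addr0; apply: cvgD; first exact: cvg_cst.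
exact: cvg_harmonic.
Qed.

Lemma des_inv_sum_gt0 (F : finFieldType) n : (0 < des_inv_sum #|F| n)%N.
Proof.
rewrite -card_subspaces; apply: leq_trans (card_subspaces_ge F n).
by rewrite expn_gt0 (ltnW (card_finField_gt1 F)).
Qed.

Theorem corollary5p2 (R : realType) (F : finFieldType) (p q a : nat)
    (hp : p \in [pchar F]) (hq : q = #|F|) (ha : a = #|field_auts F|) :
  [/\ q = (p ^ a)%N,
      asymp_equiv (fun n => (num_codes_perm F n)%:R : R)
        (fun n => (des_inv_sum q n)%:R / (n`!)%:R),
      asymp_equiv (fun n => (num_codes_monomial F n)%:R : R)
        (fun n => (des_inv_sum q n)%:R
                    / ((n`!)%:R * (q%:R - 1) ^+ n.-1))
    & asymp_equiv (fun n => (num_codes_semilinear F n)%:R : R)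
        (fun n => (des_inv_sum q n)%:R
                    / ((n`!)%:R * (q%:R - 1) ^+ n.-1 * a%:R))].
Proof.
rewrite {}hq {}ha.
have q_gt1 := card_finField_gt1 F.
have q1 : #|F|%:R - 1 = #|F|.-1%:R :> R.
  by rewrite -subn1 natrB // ltnW.
have nz_gt0 : (0 < #|[set~ (0%R : F)]|)%N by rewrite card_nonzero -subn1 subn_gt0.
have nz1 : (1 : F) \in [set~ 0] by rewrite !inE oner_neq0.
have nz0 : (0 : F) \notin [set~ 0] by rewrite !inE eqxx.
split; first exact: card_field_auts.
- have -> : (fun n => (des_inv_sum #|F| n)%:R / (n`!)%:R : R) =
      (fun n => (des_inv_sum #|F| n)%:R / ((n`!)%:R * 1%:R ^+ n.-1 * 1%:R)).
    by apply/funext=> n; rewrite expr1n !mulr1.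
  apply: asymp_equiv_of_bounds => //; first exact: des_inv_sum_gt0.
  have [||||n0 n0P] := num_classes_asymptotic (@perm1_morph F) (S := [set 1]) _ _ _ _
    (@perm_equivE F).
  + exact: set11.
  + by rewrite inE eq_sym oner_neq0.
  + by move=> x y /set1P-> /set1P->; rewrite mulr1 set11.
  + by move=> sigma x /set1P-> /set1P->; rewrite perm1 set11.
  by exists n0 => n /n0P; rewrite !cards1.
- have -> : (fun n => (des_inv_sum #|F| n)%:R / ((n`!)%:R * (#|F|%:R - 1) ^+ n.-1) : R) =
      (fun n => (des_inv_sum #|F| n)%:R / ((n`!)%:R * #|[set~ (0 : F)]|%:R ^+ n.-1 * 1%:R)).
    by apply/funext=> n; rewrite card_nonzero -q1 mulr1.
  apply: asymp_equiv_of_bounds => //; first exact: des_inv_sum_gt0.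
  have := num_classes_asymptotic (@perm1_morph F) nz1 nz0 (@nonzero_mul F)
    (nonzero_stable (@perm1_morph F)) (@monomial_equivE F).
  by rewrite cards1.
have -> : (fun n => (des_inv_sum #|F| n)%:R
             / ((n`!)%:R * (#|F|%:R - 1) ^+ n.-1 * #|field_auts F|%:R) : R) =
    (fun n => (des_inv_sum #|F| n)%:R
             / ((n`!)%:R * #|[set~ (0 : F)]|%:R ^+ n.-1 * #|field_auts F|%:R)).
  by apply/funext=> n; rewrite card_nonzero -q1.
apply: asymp_equiv_of_bounds => //; first exact: des_inv_sum_gt0.
have := num_classes_asymptotic (@field_auts_morph F) nz1 nz0 (@nonzero_mul F)
  (nonzero_stable (@field_auts_morph F)) (@semilinear_equivE F).
exact.
Qed.
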